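(* Let $k_1<\dots<k_n$ be integers. Then $$\sum_M \mathrm{W}_0(M)=\prod_{1\le p<q\le n}\left(u\,E_{k_p}+v\,E_{k_q}^{-1}+w\,E_{k_p}E_{k_q}^{-1}\right)s_{(k_n,\dots,k_1)}(X_1,\dots,X_n),$$ the sum being over all monotone triangles $M$ with bottom row $(k_1,\dots,k_n)$, and the operator expression interpreted by expanding the operator product, applying it to $(k_1,\dots,k_n)\mapsto s_{(k_n,\dots,k_1)}$ viewed as a function on $\mathbb{Z}^n$, and then evaluating at the given $k_i$.
   Context: A monotone triangle $M=(m_{i,j})_{1\le j\le i\le n}$ is an array of integers with $m_{i+1,j}\le m_{i,j}\le m_{i+1,j+1}$ and $m_{i,j}<m_{i,j+1}$; row $n$ is the bottom row. An entry $m_{i,j}$ with $i<n$ is special if $m_{i+1,j}<m_{i,j}<m_{i+1,j+1}$, left-leaning if $m_{i,j}=m_{i+1,j}$, right-leaning if $m_{i,j}=m_{i+1,j+1}$. Let $s_i,l_i,r_i$ be the numbers of special, left-leaning, right-leaning entries in row $i$ ($1\le i\le n-1$), $s_0=l_0=r_0=0$, and $l(M)=\sum l_i$, $r(M)=\sum r_i$. Put $d_i(M)=\sum_{j=1}^i m_{i,j}-\sum_{j=1}^{i-1}m_{i-1,j}+r_{i-1}(M)-l_{i-1}(M)$. The weight is $\mathrm{W}_0(M)=u^{r(M)}v^{l(M)}\prod_{i=1}^nX_i^{d_i(M)}(w+uX_i+vX_i^{-1})^{s_{i-1}(M)}$. $E_x$ is the shift operator $E_xp(x)=p(x+1)$.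 Extended Schur polynomial: for $\lambda\in\mathbb{Z}^n$, $s_\lambda=0$ if $\lambda_i-i=\lambda_j-j$ for some $i<j$; otherwise with $\sigma$ such that $\lambda_{\sigma(1)}-\sigma(1)>\dots>\lambda_{\sigma(n)}-\sigma(n)$ and an integer $p\ge0$ with $\lambda_{\sigma(n)}+n-\sigma(n)+p\ge0$, $s_\lambda=\operatorname{sgn}(\sigma)s_\mu\prod_iX_i^{-p}$ where $\mu_i=\lambda_{\sigma(i)}+i-\sigma(i)+p$ and $s_\mu$ is the ordinary Schur polynomial. *)

(* Defs.v *)
From HB Require Import structures.
From mathcomp Require Import all_boot all_order all_fingroup all_algebra.
Set Implicit Arguments.
Unset Strict Implicit.
Unset Printing Implicit Defensive.
Import Order.TTheory GRing.Theory Num.Theory.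
Local Open Scope ring_scope.

(* Triangular integer arrays.  An array is a function m : nat -> nat -> int, *)
(* read with 1-based indices m i j (row i, position j, 1 <= j <= i <= n);    *)
(* row n is the bottom row.  To sum over all arrays with a property we       *)
(* enumerate the finitely many arrays whose entries lie in the box [-S, S]   *)
(* (entries outside the triangle are 0, and the encoding is made unique).    *)

Definition arr_entry (n B : nat) (f : {ffun 'I_n * 'I_n -> 'I_B}) (i j : nat)
  : nat :=
  match (insub i.-1 : option 'I_n), (insub j.-1 : option 'I_n) with
  | Some i', Some j' => val (f (i', j'))
  | _, _ => 0%N
  end.

Definition arr (n B : nat) (a : int) (f : {ffun 'I_n * 'I_n -> 'I_B})
  : nat -> nat -> int :=
  fun i j => if [&& (0 < j)%N, (j <= i)%N & (i <= n)%N]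
             then a + (arr_entry f i j)%:Z else 0.

(* entries above the diagonal of the code are forced to 0 (unique encoding) *)
Definition canonical_code (n B : nat) (f : {ffun 'I_n * 'I_n -> 'I_B}) : bool :=
  [forall p : 'I_n * 'I_n, (p.1 < p.2)%N ==> (val (f p) == 0%N)].

Definition tri_sum (R : comNzRingType) (n S : nat)
    (P : (nat -> nat -> int) -> bool) (F : (nat -> nat -> int) -> R) : R :=
  \sum_(f : {ffun 'I_n * 'I_n -> 'I_(S.*2.+1)} |
          canonical_code f && P (arr (- S%:Z) f))
     F (arr (- S%:Z) f).

Definition is_monotone_triangle (n : nat) (m : nat -> nat -> int) : bool :=
  all (fun i => all (fun j => (m i.+1 j <= m i j) && (m i j <= m i.+1 j.+1))
                    (iota 1 i)) (iota 1 n.-1)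
  && all (fun i => all (fun j => m i j < m i j.+1) (iota 1 i.-1)) (iota 1 n).

(* bottom row (row n) equals (k_1, ..., k_n); k is 0-based: k_j = k (j-1) *)
Definition has_bottom_row (n : nat) (k : 'I_n -> int) (m : nat -> nat -> int)
  : bool := [forall j : 'I_n, m n j.+1 == k j].

Definition s_cnt (n : nat) (m : nat -> nat -> int) (i : nat) : nat :=
  if (i < n)%N then
    count (fun j => (m i.+1 j < m i j) && (m i j < m i.+1 j.+1)) (iota 1 i)
  else 0%N.
Definition l_cnt (n : nat) (m : nat -> nat -> int) (i : nat) : nat :=
  if (i < n)%N then count (fun j => m i j == m i.+1 j) (iota 1 i) else 0%N.
Definition r_cnt (n : nat) (m : nat -> nat -> int) (i : nat) : nat :=
  if (i < n)%N then count (fun j => m i j == m i.+1 j.+1) (iota 1 i) else 0%N.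

Definition l_tot (n : nat) (m : nat -> nat -> int) : nat :=
  (\sum_(1 <= i < n) l_cnt n m i)%N.
Definition r_tot (n : nat) (m : nat -> nat -> int) : nat :=
  (\sum_(1 <= i < n) r_cnt n m i)%N.

Definition d_exp (n : nat) (m : nat -> nat -> int) (i : nat) : int :=
  \sum_(1 <= j < i.+1) m i j - \sum_(1 <= j < i) m i.-1 j
  + (r_cnt n m i.-1)%:Z - (l_cnt n m i.-1)%:Z.

(* W_0(M); X is 0-based: X_i = X (i-1) *)
Definition W0 (R : comUnitRingType) (n : nat) (u v w : R) (X : 'I_n -> R)
    (m : nat -> nat -> int) : R :=
  u ^+ r_tot n m * v ^+ l_tot n m *
  \prod_(i < n) (X i ^ d_exp n m i.+1 *
                 (w + u * X i + v * (X i)^-1) ^+ s_cnt n m i).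

Definition MT_sum (R : comUnitRingType) (n : nat) (u v w : R) (X : 'I_n -> R)
    (k : 'I_n -> int) : R :=
  tri_sum n (\sum_(i < n) absz (k i))%N
    (fun m => is_monotone_triangle n m && has_bottom_row k m)
    (W0 u v w X).

(* Gelfand-Tsetlin patterns with top row mu (row n):
   g_{i+1,j+1} <= g_{i,j} <= g_{i+1,j} *)
Definition is_GT_pattern (n : nat) (g : nat -> nat -> int) : bool :=
  all (fun i => all (fun j => (g i.+1 j.+1 <= g i j) && (g i j <= g i.+1 j))
                    (iota 1 i)) (iota 1 n.-1).

Definition GT_weight (R : comUnitRingType) (n : nat) (X : 'I_n -> R)
    (g : nat -> nat -> int) : R :=
  \prod_(i < n) X i ^ (\sum_(1 <= j < i.+2) g i.+1 j - \sum_(1 <= j < i.+1) g i j).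

(* ordinary Schur polynomial s_mu(X_1,...,X_n) for a partition
   mu_1 >= ... >= mu_n >= 0 (mu 0-based), as the generating function of
   Gelfand-Tsetlin patterns (= semistandard Young tableaux) of shape mu *)
Definition schur (R : comUnitRingType) (n : nat) (X : 'I_n -> R)
    (mu : 'I_n -> int) : R :=
  tri_sum n (\sum_(i < n) absz (mu i))%N
    (fun g => is_GT_pattern n g && has_bottom_row mu g)
    (GT_weight X).

(* extended Schur polynomial s_lambda for lambda in Z^n (0-based lambda);
   p is chosen as sum_i |lambda_i|, which satisfies the required inequality *)
Definition schur_ext (R : comUnitRingType) (n : nat) (X : 'I_n -> R)
    (lam : 'I_n -> int) : R :=
  if [exists i : 'I_n, exists j : 'I_n,
        (i < j)%N && (lam i - (i : nat)%:Z == lam j - (j : nat)%:Z)]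
  then 0
  else
    match [pick s : 'S_n | [forall i : 'I_n, forall j : 'I_n, (i < j)%N ==>
             (lam (s j) - (s j : nat)%:Z < lam (s i) - (s i : nat)%:Z)]] with
    | Some s =>
        let p : int := (\sum_(i < n) absz (lam i))%N%:Z in
        (-1) ^+ odd_perm s *
        schur X (fun i => lam (s i) + (i : nat)%:Z - (s i : nat)%:Z + p) *
        \prod_(i < n) X i ^ (- p)
    | None => 0
    end.

(* Shift operators: a finite formal sum  sum_t c_t E^{a_t}  with             *)
(* E^a = prod_i E_{k_i}^{a_i}, a in Z^n, represented as a list of pairs.     *)

Definition shift_op (R : comUnitRingType) (n : nat) := seq (R * ('I_n -> int)).

Definition op_one (R : comUnitRingType) (n : nat) : shift_op R n :=
  [:: (1, fun _ => 0)].

Definition op_mul (R : comUnitRingType) (n : nat) (L1 L2 : shift_op R n)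
  : shift_op R n :=
  [seq (t1.1 * t2.1, fun i => t1.2 i + t2.2 i) | t1 <- L1, t2 <- L2].

Definition unitv (n : nat) (p : 'I_n) : 'I_n -> int :=
  fun i => if i == p then 1 else 0.

Definition pair_factor (R : comUnitRingType) (n : nat) (u v w : R)
    (p q : 'I_n) : shift_op R n :=
  [:: (u, unitv p); (v, fun i => - unitv q i);
      (w, fun i => unitv p i - unitv q i)].

Definition ord_pairs (n : nat) : seq ('I_n * 'I_n) :=
  flatten (map (fun p : 'I_n => map (fun q : 'I_n => (p, q)) (filter (fun q : 'I_n => (p < q)%N) (enum 'I_n))) (enum 'I_n)).

Definition op_prod (R : comUnitRingType) (n : nat) (u v w : R) : shift_op R n :=
  foldr (fun pq acc => op_mul (pair_factor u v w pq.1 pq.2) acc)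
        (op_one R n) (ord_pairs n).

Definition op_apply (R : comUnitRingType) (n : nat) (L : shift_op R n)
    (f : ('I_n -> int) -> R) (k : 'I_n -> int) : R :=
  \sum_(t <- L) t.1 * f (fun i => k i + t.2 i).

Definition schur_rev (R : comUnitRingType) (n : nat) (X : 'I_n -> R)
    (k : 'I_n -> int) : R :=
  schur_ext X (fun i => k (rev_ord i)).

(* Main.v *)
Require Import Defs.
From HB Require Import structures.
From mathcomp Require Import all_boot all_order all_fingroup all_algebra.
From mathcomp Require Import zify ring lra.
From mathcomp.multinomials Require Import mpoly.
Set Implicit Arguments.
Unset Strict Implicit.
Unset Printing Implicit Defensive.
Import Order.TTheory GRing.Theory Num.Theory.
Local Open Scope ring_scope.

(** Put [c(a,b) = u a b + v + w a].  Over a field, for [k_1 < ... < k_n],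
[[
  (sum_M W_0(M)) * prod_(i<j) (X_j - X_i)
    = sum_s sgn(s) prod_p X_(s p)^(k_p) prod_(p<q) c(X_(s p), X_(s q)),
]]
by induction on [n].  Summing over the row above the bottom row for a fixed
[s] in S_(n-1), the geometric sum of the [i]-th entry times [X_n - X_(s i)] is
a difference [P_i - Q_i], with [P_i] carrying the exponent [k_i] and [Q_i] the
exponent [k_(i+1)]; strictness of the row subtracts a term [g_i] for each pair
of consecutive entries.  Expanding, every monomial with a factor
[Q_i P_(i+1) + g_i] is killed by the antisymmetrization in
[X_(s i), X_(s (i+1))], because with [a], [b], [c] for [X_(s i)],
[X_(s (i+1))], [X_n],
[[
  (u a c + v + w c) (u b c + v + w b) + u v (a - c) (b - c)
    = (u a b + v + w b) (u c^2 + v + w c).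
]]
What remains is [P_1 ... P_(m-1) (-Q_m) ... (-Q_(n-1))], [m = 1, ..., n], and
this is the expansion of the sum over S_n according to the position of [X_n].

The case [u = w = 0], [v = 1] is the bialternant formula for Schur
polynomials, after the usual shift of Gelfand-Tsetlin patterns.  A shift
operator multiplies each term of an alternant by a monomial, so the operator
product produces [prod_(p<q) c(X_(s p), X_(s q))], up to [prod_p X_(s p)^p].
The general case follows by specializing the field of fractions of
[Z[X_1, ..., X_n, u, v, w]]. *)

(** * Sums over strict interlacing rows *)

Definition irange (a b : int) : seq int :=
  [seq a + i%:Z | i <- iota 0 (if a <= b then (absz (b - a)).+1 else 0)].

Lemma mem_irange a b x : (x \in irange a b) = (a <= x <= b).
Proof.
apply/mapP/idP => [[i]|].
  by rewrite mem_iota; case: ifP => hab hi -> ; lia.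
by move=> h; exists (absz (x - a)); rewrite ?mem_iota; first case: ifP => hab; lia.
Qed.

Lemma irange_uniq a b : uniq (irange a b).
Proof. by rewrite map_inj_uniq ?iota_uniq // => i j; lia. Qed.

Fixpoint inter (k : seq int) : seq (seq int) :=
  if k is a :: k' then
    if k' is b :: _ then [seq x :: l | x <- irange a b, l <- inter k']
    else [:: [::]]
  else [::].

Lemma inter_cons2 a b k : 
  inter (a :: b :: k) = [seq x :: l | x <- irange a b, l <- inter (b :: k)].
Proof. by []. Qed.

Lemma inter_uniq k : uniq (inter k).
Proof.
elim: k => [|a [|b k] IH] //; rewrite inter_cons2.
by apply: allpairs_uniq => [||[x l] [x' l'] _ _ [-> ->]] //; exact: irange_uniq.
Qed.

Lemma mem_inter (k l : seq int) : k != [::] ->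
  reflect (size k = (size l).+1 /\
           forall i, (i < size l)%N -> k`_i <= l`_i <= k`_i.+1)
          (l \in inter k).
Proof.
elim: k l => [|a [|b k] IH] l // _.
  rewrite /= inE; apply: (iffP eqP) => [-> //|[[/esym/size0nil //]]].
rewrite inter_cons2; apply: (iffP allpairsP) => [[[x l'] [/= hx hl ->]]|[]].
  have {hl} [hs hl'] := elimT (IH l' isT) hl.
  split=> [|[|i]] /=; first by move: hs => /= ->.
    by rewrite -mem_irange.
  by move=> hi; apply: hl'.
case: l => // x l /= [hs] hl; exists (x, l); split=> //=.
  by rewrite mem_irange; exact: (hl 0%N).
by apply/(IH l isT); split=> [|i hi] /=; [rewrite -hs|exact: (hl i.+1)].
Qed.

Definition strict := sorted (fun x y : int => x < y).

Section StrictSum.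
Variable R : comNzRingType.
Implicit Types (phi : nat -> int -> R).

(** The weight may depend on the position of an entry. The offset [j] preserves absolute positions
    when the recursion passes to a tail of the row. *)
Fixpoint wprod phi (j : nat) (l : seq int) : R :=
  if l is x :: l' then phi j x * wprod phi j.+1 l' else 1.

Lemma wprodE phi j l : wprod phi j l = \prod_(i < size l) phi (j + i)%N l`_i.
Proof.
elim: l j => [|x l IH] j /=; first by rewrite big_ord0.
rewrite big_ord_recl /= addn0 IH; congr (_ * _).
by apply: eq_bigr => i _; rewrite addSnnS.
Qed.

Definition strict_sum phi j (k : seq int) : R :=
  \sum_(l <- inter k | strict l) wprod phi j l.

Lemma eq_strict_sum phi psi j k :
  (forall i x, (j <= i)%N -> phi i x = psi i x) ->
  strict_sum phi j k = strict_sum psi j k.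
Proof.
move=> h; apply: eq_bigr => l _; rewrite !wprodE; apply: eq_bigr => i _.
by rewrite h ?leq_addr.
Qed.

Lemma strict_sum1 phi j a : strict_sum phi j [:: a] = 1.
Proof. by rewrite /strict_sum /= big_cons big_nil /= addr0. Qed.

Lemma strict_sum2 phi j a b :
  strict_sum phi j [:: a; b] = \sum_(x <- irange a b) phi j x.
Proof.
rewrite /strict_sum inter_cons2 big_mkcond big_allpairs_dep /=.
by apply: eq_bigr => x _; rewrite big_cons big_nil /= addr0 mulr1.
Qed.

(** With first entry [b], the next entry is at least [c > b], so strictness at the first step is
    automatic and the remaining entries form an arbitrary strict row for [c :: k]. *)
Lemma strict_sum_head phi j b c k : b < c ->
  \sum_(l <- inter [:: b, c & k] | strict l && (head 0 l == b)) wprod phi j l =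
  phi j b * strict_sum phi j.+1 (c :: k).
Proof.
move=> bc; rewrite inter_cons2 big_mkcond big_allpairs_dep /=.
rewrite (bigD1_seq b) ?irange_uniq ?mem_irange ?lexx ?ltW //= eqxx.
rewrite [X in _ + X]big1 ?addr0 => [|y /negbTE yb]; last first.
  by rewrite big1 // => l _; rewrite yb andbF.
rewrite /strict_sum mulr_sumr [RHS]big_mkcond; apply: eq_big_seq => l hl.
rewrite andbT; case: l hl => //= y l.
case: k => [|d k]; first by rewrite /= inE.
move=> /allpairsP[[y0 l0] [/=]] + _ [-> _].
by rewrite mem_irange => /andP[cy _]; rewrite (lt_le_trans bc cy).
Qed.

(* Strictness can only fail through two consecutive entries both equal to the *)
(* bottom entry b between them; such failures never overlap.                  *)
Lemma strict_sum3 phi j a b c k : a < b -> b < c ->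
  strict_sum phi j [:: a, b, c & k] =
  (\sum_(x <- irange a b) phi j x) * strict_sum phi j.+1 [:: b, c & k] -
  phi j b * phi j.+1 b * strict_sum phi j.+2 (c :: k).
Proof.
move=> ab bc; rewrite -mulrA -strict_sum_head // /strict_sum inter_cons2.
rewrite big_mkcond big_allpairs_dep /= -/(inter [:: b, c & k]) mulr_suml.
rewrite [X in _ - X](_ : _ = \sum_(x <- irange a b | x == b)
   phi j x * \sum_(l <- inter [:: b, c & k] | strict l && (head 0 l == b)) wprod phi j.+1 l).
  rewrite [X in _ - X]big_mkcond -sumrB; apply: eq_big_seq => x.
  rewrite mem_irange => /andP[ax xb].
  case: eqP => [xeb|xneb].
    (* For [x = b] the rows [l] starting with [b] cancel against the correction term. Those that are
       left are exactly the rows that stay strict with [b] in front. *)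
    rewrite -mulrBr [X in X - _](bigID (fun l => head 0 l == b)) /= addrC addrK.
    rewrite mulr_sumr [RHS]big_mkcond; apply: eq_big_seq => l hl.
    case: l hl => [|y l hl]; first by move=> /allpairsP[[? ?] []].
    have /andP[by_ _] : b <= y <= c.
      by case/allpairsP: hl => [[y' l'] [/=]] + _ [-> _]; rewrite mem_irange.
    by rewrite /= xeb (lt_neqAle b y) by_ eq_sym andbT andbC.
  rewrite subr0 mulr_sumr [RHS]big_mkcond; apply: eq_big_seq => l hl.
  case: l hl => [|y l hl]; first by move=> /allpairsP[[? ?] []].
  have /andP[by_ _] : b <= y <= c.
    by case/allpairsP: hl => [[y' l'] [/=]] + _ [-> _]; rewrite mem_irange.
  suff xy : x < y by rewrite /= xy mulrA.
  by rewrite (lt_le_trans _ by_) // lt_neqAle xb andbT; apply/eqP.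
rewrite [RHS]big_mkcond (bigD1_seq b) ?irange_uniq ?mem_irange ?lexx ?ltW //= eqxx.
by rewrite [X in _ = _ + X]big1 ?addr0 // => x /negbTE ->.
Qed.
End StrictSum.

(** * Antisymmetrization *)

Section Antisymmetrizer.
Variables (R : comNzRingType) (n : nat).

(** The transposition matches odd permutations with even ones, and matched terms cancel. No division
    by 2 occurs, so any characteristic is allowed. *)
Lemma asym_sum0 (phi : 'S_n -> R) (o o' : 'I_n) : o != o' ->
  (forall s, phi (tperm o o' * s)%g = phi s) ->
  \sum_(s : 'S_n) (-1) ^+ odd_perm s * phi s = 0.
Proof.
move=> oo' hphi; rewrite (bigID (fun s : 'S_n => odd_perm s)) /=.
rewrite (reindex_inj (mulgI (tperm o o'))) /=.
rewrite [X in X + _](eq_bigl (fun s : 'S_n => ~~ odd_perm s)) => [|s]; last first.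
  by rewrite odd_mul_tperm oo'; case: odd_perm.
rewrite -big_split big1 // => s /negbTE hs /=.
by rewrite odd_mul_tperm oo' hphi hs /= expr1 expr0 mulN1r mul1r addNr.
Qed.

(** [C] is the product of the pair factors and [Z j] the sum over the part of a strict row from
    position [j] on. [P i] and [Q i] are the two end terms of the geometric sum of entry [i], and
    [h j] stands for [Q j * P j.+1] plus the strictness correction [g] of the overview. *)
Variables (C : 'S_n -> R) (P Q Z h : nat -> 'S_n -> R).

Definition asym (phi : 'S_n -> R) : R :=
  \sum_(s : 'S_n) (-1) ^+ odd_perm s * (C s * phi s).

(** This is how a prefactor built from positions before [j] behaves; it may then be carried along
    through the later positions. *)
Definition inv_from j (pre : 'S_n -> R) := forall o o' : 'I_n,
  o' = o.+1 :> nat -> (j <= o)%N -> forall s, pre (tperm o o' * s)%g = pre s.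

Lemma eq_asym phi psi : phi =1 psi -> asym phi = asym psi.
Proof. by move=> e; apply: eq_bigr => s _; rewrite e. Qed.

Lemma asymD phi psi : asym (fun s => phi s + psi s) = asym phi + asym psi.
Proof. by rewrite -big_split; apply: eq_bigr => s _; rewrite !mulrDr. Qed.

Hypothesis HP : forall (i : nat) (o o' : 'I_n) s,
  o' = o.+1 :> nat -> i != o :> nat -> i != o' :> nat -> P i (tperm o o' * s)%g = P i s.
Hypothesis HQ : forall (i : nat) (o o' : 'I_n) s,
  o' = o.+1 :> nat -> i != o :> nat -> i != o' :> nat -> Q i (tperm o o' * s)%g = Q i s.
Hypothesis HZ : forall (i : nat) (o o' : 'I_n) s,
  o' = o.+1 :> nat -> (o' < i)%N -> Z i (tperm o o' * s)%g = Z i s.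
Hypothesis Hh : forall (o o' : 'I_n) s, o' = o.+1 :> nat ->
  C (tperm o o' * s)%g * h o (tperm o o' * s)%g = C s * h o s.
Hypothesis Zn : forall s, Z n s = 1.
Hypothesis Zn1 : forall j s, j.+1 = n -> Z j s = P j s - Q j s.
Hypothesis Zrec : forall j s, (j.+1 < n)%N ->
  Z j s = (P j s - Q j s) * Z j.+1 s - (h j s - Q j s * P j.+1 s) * Z j.+2 s.

(** [C s * h j s] is symmetric in positions [j] and [j.+1] by [Hh], and swapping these positions
    changes neither [pre] nor [Z j.+2]. *)
Lemma asym_h0 j pre : (j.+1 < n)%N -> inv_from j pre ->
  asym (fun s => pre s * (h j s * Z j.+2 s)) = 0.
Proof.
move=> hj hpre.
pose o := Ordinal (ltnW hj); pose o' := Ordinal hj.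
apply: (@asym_sum0 _ o o'); first by rewrite -val_eqE /= neq_ltn leqnn.
move=> s; rewrite hpre // HZ //.
have e := @Hh o o' s erefl.
by rewrite mulrCA [in RHS]mulrCA; congr (_ * _); rewrite !mulrA e.
Qed.

(** By [Zrec], [Z j - P j * Z j.+1] equals [- Q j * (Z j.+1 - P j.+1 * Z j.+2) - h j * Z j.+2]. The
    last term is killed by [asym_h0], and the induction continues with [- Q j] absorbed in [pre]. *)
Lemma asym_Q j pre : (j < n)%N -> inv_from j pre ->
  asym (fun s => pre s * (Z j s - P j s * Z j.+1 s)) =
  asym (fun s => pre s * \prod_(j <= i < n) - Q i s).
Proof.
elim: {j}(n - j)%N {-2}j (erefl (n - j)%N) pre => [|d IH] j hd pre jn hpre.
  by lia.
have [hj|hj] := ltnP j.+1 n; last first.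
  have ejn : j.+1 = n by apply/eqP; rewrite eqn_leq jn.
  apply: eq_asym => s; rewrite Zn1 // ejn Zn big_ltn // big_geq -?ejn // !mulr1.
  by rewrite addrAC subrr add0r.
transitivity (asym (fun s => (pre s * - Q j s) * (Z j.+1 s - P j.+1 s * Z j.+2 s))
   + asym (fun s => - pre s * (h j s * Z j.+2 s))).
  by rewrite -asymD; apply: eq_asym => s; rewrite Zrec //; ring.
rewrite asym_h0 ?addr0 //; last by move=> o o' e jo s; rewrite hpre.
rewrite IH //; first last.
- by move=> o o' e jo s; rewrite hpre ?HQ ?(ltnW jo) //; lia.
- by lia.
by apply: eq_asym => s; rewrite [in RHS]big_ltn ?mulrA.
Qed.

(** Writing [Z j] as [(Z j - P j * Z j.+1) + P j * Z j.+1], the first part gives the summand [m = j]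
    by [asym_Q]. The second part gives the summands [m > j] by induction, with [P j] absorbed in
    [pre]. *)
Lemma asym_expand j pre : (j <= n)%N -> inv_from j pre ->
  asym (fun s => pre s * Z j s) =
  asym (fun s => pre s * \sum_(j <= m < n.+1)
    ((\prod_(j <= i < m) P i s) * \prod_(m <= i < n) - Q i s)).
Proof.
elim: {j}(n - j)%N {-2}j (erefl (n - j)%N) pre => [|d IH] j hd pre jn hpre.
  have -> : j = n by lia.
  by apply: eq_asym => s; rewrite Zn big_nat1 !big_geq ?mulr1.
have {}jn : (j < n)%N by lia.
transitivity (asym (fun s => pre s * (Z j s - P j s * Z j.+1 s)) +
              asym (fun s => (pre s * P j s) * Z j.+1 s)).
  by rewrite -asymD; apply: eq_asym => s; ring.
rewrite asym_Q // IH //; [|lia|]; last first.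
  by move=> o o' e jo s; rewrite hpre ?HP ?(ltnW jo) //; lia.
rewrite -asymD; apply: eq_asym => s.
rewrite -mulrA -mulrDr [in RHS]big_ltn ?ltnS ?(ltnW jn) //.
rewrite (big_geq (leqnn j)) mul1r mulr_sumr; congr (_ * (_ + _)).
by apply: eq_big_nat => m /andP[jm _]; rewrite [in RHS]big_ltn ?mulrA.
Qed.

End Antisymmetrizer.

(** * Triangles as sequences of rows *)

Definition tri_row (m : nat -> nat -> int) i : seq int := mkseq (fun j => m i j.+1) i.

Arguments tri_row : simpl never.

Lemma size_tri_row m i : size (tri_row m i) = i.
Proof. exact: size_mkseq. Qed.

Lemma nth_tri_row m i j : (j < i)%N -> (tri_row m i)`_j = m i j.+1.
Proof. exact: nth_mkseq. Qed.

(* The rows of a triangle of order n, bottom row first. *)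
Fixpoint rows_of n (m : nat -> nat -> int) : seq (seq int) :=
  if n is n'.+1 then tri_row m n :: rows_of n' m else [::].

Lemma eq_rows_of n m m' :
  rows_of n m = rows_of n m' <->
  (forall i j, (0 < j <= i)%N -> (i <= n)%N -> m i j = m' i j).
Proof.
elim: n => [|n IH] /=; first by split=> // _ i j; lia.
split=> [e i j ji|h].
  have h := IH.1 (congr1 behead e).
  rewrite leq_eqVlt => /predU1P[ein|]; last exact: h.
  have jn : (j.-1 < n.+1)%N by lia.
  have /= := congr1 (fun s => (head [::] s)`_j.-1) e.
  by rewrite !nth_tri_row // prednK ?ein //; lia.
congr (_ :: _); last by apply: IH.2 => i j ji ni; apply: h => //; exact: leqW.
by apply/eq_in_map => j; rewrite mem_iota => hj; apply: h; lia.
Qed.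

Fixpoint triangular n (t : seq (seq int)) : bool :=
  if n is n'.+1 then
    if t is k :: t' then (size k == n) && triangular n' t' else false
  else t == [::].

Lemma rows_of_nth n t : triangular n t ->
  rows_of n (fun i j => (nth [::] t (n - i))`_j.-1) = t.
Proof.
elim: n t => [|n IH] [|k t] //= /andP[/eqP sk /IH e]; congr (_ :: _).
  apply: (@eq_from_nth _ 0); rewrite ?size_tri_row ?sk // => i hi.
  by rewrite nth_tri_row // subnn.
by rewrite -[RHS]e; apply: (eq_rows_of _ _ _).2 => i j ji ni; rewrite subSn.
Qed.

Section Triangles.
(** [next k] lists the rows allowed above the row [k]. It is instantiated by [mt_next] for monotone
    triangles and by [gt_next] for Gelfand-Tsetlin patterns. *)
Variable next : seq int -> seq (seq int).
Hypothesis next_uniq : forall k, uniq (next k).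
Hypothesis size_next : forall k l : seq int, k != [::] -> l \in next k -> size k = (size l).+1.

Lemma next_size n k l : size k = n.+1 -> l \in next k -> size l = n.
Proof.
move=> sk hl; have k0 : k != [::] by case: (k) sk.
by have := size_next k0 hl; rewrite sk => -[].
Qed.

Fixpoint tris n (k : seq int) : seq (seq (seq int)) :=
  if n is n'.+1 then [seq k :: t | l <- next k, t <- tris n' l] else [:: [::]].

Lemma tris_triangular n k t : size k = n -> t \in tris n k ->
  triangular n t /\ head [::] t = k.
Proof.
elim: n k t => [|n IH] k t sk /=; first by rewrite inE => /eqP ->; case: k sk.
case/allpairsPdep => l [t' [hl ht' ->]] /=; rewrite sk eqxx.
have sl : size l = n.
  exact: next_size sk hl.
by have [-> _] := IH _ _ sl ht'.
Qed.

Lemma tris_uniq n k : size k = n -> uniq (tris n k).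
Proof.
elim: n k => [|n IH] k sk //=.
have sl l : l \in next k -> size l = n.
  exact: next_size sk.
apply: allpairs_uniq_dep => // [l hl|]; first by rewrite IH ?sl.
move=> [l t] [l' t'] /allpairsPdep[l1 [t1 [h1 h1' [-> ->]]]].
move=> /allpairsPdep[l2 [t2 [h2 h2' [-> ->]]]] /= [e].
have [_ e1] := tris_triangular (sl _ h1) h1'.
have [_ e2] := tris_triangular (sl _ h2) h2'.
by rewrite -e1 -e2 e.
Qed.

Definition chain n (m : nat -> nat -> int) : bool :=
  all (fun i => tri_row m i \in next (tri_row m i.+1)) (iota 0 n).

Lemma mem_tris n k m : size k = n ->
  (rows_of n m \in tris n k) = (tri_row m n == k) && chain n m.
Proof.
elim: n k => [|n IH] k sk; first by case: k sk.
rewrite /chain -addn1 iotaD all_cat -/(chain n m) addn1 /= andbT.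
have sl l : l \in next k -> size l = n.
  exact: next_size sk.
apply/allpairsPdep/and3P => [[l [t [hl ht [e et]]]]|[/eqP e hc hl]].
  by move: ht; rewrite -et IH ?sl // => /andP[/eqP -> ->]; rewrite e.
exists (tri_row m n), (rows_of n m); rewrite -e; split=> //.
by rewrite IH ?size_tri_row // eqxx.
Qed.

Lemma tris_all (p : pred int) n k t :
  (forall k l, k != [::] -> l \in next k -> all p k -> all p l) ->
  size k = n -> all p k -> t \in tris n k -> all (all p) t.
Proof.
move=> hp; elim: n k t => [|n IH] k t sk pk /=; first by rewrite inE => /eqP ->.
case/allpairsPdep => l [t' [hl ht' ->]] /=; rewrite pk /=.
by apply: IH ht'; [exact: next_size hl | apply: hp hl pk; case: (k) sk].
Qed.

Variables (R : comNzRingType) (wt : nat -> seq int -> seq int -> R).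

Fixpoint rec_sum n (k : seq int) : R :=
  if n is n'.+1 then \sum_(l <- next k) wt n' k l * rec_sum n' l else 1.

Fixpoint tri_wt n (t : seq (seq int)) : R :=
  if n is n'.+1 then wt n' (head [::] t) (head [::] (behead t)) * tri_wt n' (behead t)
  else 1.

Lemma tri_wt_rows n m :
  tri_wt n (rows_of n m) = \prod_(i < n) wt i (tri_row m i.+1) (tri_row m i).
Proof.
elim: n => [|n IH]; first by rewrite big_ord0.
by rewrite big_ord_recr /= IH mulrC; case: (n).
Qed.

Lemma sum_tris n k : size k = n -> \sum_(t <- tris n k) tri_wt n t = rec_sum n k.
Proof.
elim: n k => [|n IH] k sk /=; first by rewrite big_cons big_nil addr0.
rewrite big_allpairs_dep /=; apply: eq_big_seq => l hl.
have sl : size l = n.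
  exact: next_size sk hl.
rewrite -IH // mulr_sumr; apply: eq_big_seq => t ht.
by have [_ ->] := tris_triangular sl ht.
Qed.

(** Both sums run over duplicate-free lists with the same members. A canonical code is determined by
    the rows of its array, and the bound [S] ensures that every triangle in [tris n k] has a
    code. *)
Lemma tri_sum_rec n S k (P : (nat -> nat -> int) -> bool) (f : (nat -> nat -> int) -> R) :
  size k = n ->
  (forall m, P m = (tri_row m n == k) && chain n m) ->
  (forall m, P m -> f m = \prod_(i < n) wt i (tri_row m i.+1) (tri_row m i)) ->
  (forall t l x, t \in tris n k -> l \in t -> x \in l -> `|x| <= S%:Z) ->
  tri_sum n S P f = rec_sum n k.
Proof.
move=> sk hP hf hS; rewrite -sum_tris // /tri_sum.
pose Q (g : {ffun 'I_n * 'I_n -> 'I_(S.*2.+1)}) := canonical_code g && P (arr (- S%:Z) g).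
transitivity (\sum_(t <- [seq rows_of n (arr (- S%:Z) g) | g <- enum Q]) tri_wt n t).
  rewrite big_map [RHS]big_enum_cond /=; apply: eq_big => [g|g /andP[_ hg]].
    by rewrite andbT.
  by rewrite hf // tri_wt_rows.
apply: perm_big; apply: uniq_perm; rewrite ?tris_uniq //.
  rewrite map_inj_in_uniq ?enum_uniq // => g g'; rewrite !mem_enum.
  move=> /andP[/forallP cg _] /andP[/forallP cg' _] /(eq_rows_of _ _ _).1 e.
  apply/ffunP => -[a b]; apply/val_inj.
  have [ab|ba] := ltnP a b.
    move/implyP: (cg (a, b)) => /(_ ab)/eqP ->.
    by move/implyP: (cg' (a, b)) => /(_ ab)/eqP ->.
  have := e a.+1 b.+1 ba (ltn_ord a).
  by rewrite /arr (ba : (b.+1 <= a.+1)%N) ltn_ord /= /arr_entry /= !valK => /addrI[].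
move=> t; apply/mapP/idP => [[g]|ht].
  by rewrite mem_enum => /andP[_]; rewrite hP -mem_tris // => h ->.
have [tt _] := tris_triangular sk ht.
pose m i j := (nth [::] t (n - i))`_j.-1.
have mS i j : `|m i j| <= S%:Z.
  rewrite /m; have [hi|hi] := ltnP (n - i) (size t); last first.
    by rewrite (nth_default [::] hi) nth_nil normr0.
  have [hj|hj] := ltnP j.-1 (size (nth [::] t (n - i))); last first.
    by rewrite (nth_default 0 hj) normr0.
  by apply: (hS _ (nth [::] t (n - i)) _ ht); rewrite mem_nth.
(* The code stores each entry raised by [S], undoing the offset in [arr], and 0 above the diagonal
   as [canonical_code] requires. *)
pose g : {ffun 'I_n * 'I_n -> 'I_(S.*2.+1)} :=
  [ffun p : 'I_n * 'I_n => if (p.1 < p.2)%N then ord0 else inord (absz (m p.1.+1 p.2.+1 + S%:Z)%R)].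
have gm : rows_of n (arr (- S%:Z) g) = t.
  rewrite -[RHS](rows_of_nth tt); apply: (eq_rows_of _ _ _).2 => i j ji ni.
  case/andP: (ji) => j0 ij; rewrite /arr j0 ij ni /=.
  rewrite -/(m i j) /arr_entry.
  have hi : (i.-1 < n)%N by lia. have hj : (j.-1 < n)%N by lia.
  rewrite !insubT /= ffunE /= ltnNge (_ : (j.-1 <= i.-1)%N) /=; last by lia.
  have -> : i.-1.+1 = i by lia. have -> : j.-1.+1 = j by lia.
  have := mS i j => hm.
  by rewrite inordK; lia.
exists g => //; rewrite mem_enum; apply/andP; split.
  by apply/forallP => -[a b]; apply/implyP => /= ab; rewrite ffunE /= ab.
by rewrite hP -mem_tris // gm.
Qed.

End Triangles.

(** * The bialternant formula *)

(** Permutations are sorted by the position [m] that is sent to [ord_max]. The parametrization is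
    injective, hence bijective because [(n.+1)! = n.+1 * n!]. *)
Lemma big_lift_perm (R : comNzRingType) n (F : 'S_n.+1 -> R) :
  \sum_s F s = \sum_(m < n.+1) \sum_(s : 'S_n) F (lift_perm m ord_max s).
Proof.
pose h (ms : 'I_n.+1 * 'S_n) := lift_perm ms.1 ord_max ms.2.
have h_inj : injective h.
  move=> [m s] [m' s'] e.
  have em : m = m'.
    have : h (m, s) m' = h (m, s) m by rewrite {1}e !lift_perm_id.
    by move/perm_inj.
  rewrite -em in e *; congr (_, _); apply/permP => i.
  have := congr1 (fun t : 'S_n.+1 => t (lift m i)) e.
  by rewrite !lift_perm_lift => /lift_inj.
rewrite pair_big (reindex h) //=.
apply: onW_bij; apply: inj_card_bij => //.
by rewrite card_prod card_ord !card_Sn factS.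
Qed.

Lemma prod_nat_ltn (R : comNzRingType) n m (f : nat -> R) : (m <= n)%N ->
  \prod_(0 <= i < m) f i = \prod_(i < n) (if (i < m)%N then f i else 1).
Proof. by move=> mn; rewrite (big_nat_widen _ _ _ _ _ mn) big_mkord big_mkcond. Qed.

Lemma prod_nat_geq (R : comNzRingType) n m (f : nat -> R) :
  \prod_(m <= i < n) f i = \prod_(i < n) (if (i < m)%N then 1 else f i).
Proof.
rewrite (big_nat_widenl m 0) // big_mkord big_mkcond /=.
by apply: eq_bigr => i _; rewrite ltnNge; case: (m <= i)%N.
Qed.

Section Bialternant.
Variables (F : fieldType) (u v w : F) (X : nat -> F).
Hypothesis X0 : forall i, X i != 0.

Definition pairc a b : F := u * a * b + v + w * a.

Definition pair_prod n (s : 'S_n) : F :=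
  \prod_(p < n) \prod_(q < n | (p < q)%N) pairc (X (s p)) (X (s q)).

Definition alt_sum n (e : nat -> int) : F :=
  \sum_(s : 'S_n) (-1) ^+ odd_perm s * (pair_prod s * \prod_(p < n) X (s p) ^ e p).

Definition vander n : F := \prod_(j < n) \prod_(i < j) (X j - X i).

(** For [a < b], this is the share of one entry [x] in [W0]: a left-leaning entry carries [v] and
    lowers the exponent of [c] by one, a right-leaning entry carries [u] and raises it. The factor
    [c ^ (- x)] comes from the row sum subtracted in [d_exp]. *)
Definition entry_weight (c : F) (a b x : int) : F :=
  c ^ (- x) * (if x == a then v / c else if x == b then u * c
               else w + u * c + v / c).

Definition step_weight c (k l : seq int) : F :=
  c ^ (\sum_(x <- k) x) * wprod (fun j => entry_weight c k`_j k`_j.+1) 0 l.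

Definition mt_next (k : seq int) := [seq l <- inter k | strict l].

Definition mt_gen := rec_sum mt_next (fun n => step_weight (X n)).

(** A geometric sum in [z = y / c]: multiplication by [c - y = c * (1 - z)] telescopes the interior
    terms. The end weights [v / c] and [u * c] complete what is left at [z ^ a] and [z ^ b] to
    [pairc y c] and [- pairc c y]. *)
Lemma sum_entry_weight (c y : F) (a b : int) : c != 0 -> y != 0 -> a < b ->
  \sum_(x <- irange a b) entry_weight c a b x * y ^ x * (c - y) =
  (y / c) ^ a * pairc y c - (y / c) ^ b * pairc c y.
Proof.
move=> c0 y0 ab; pose z := y / c.
have z0 : z != 0 by rewrite mulf_neq0 ?invr_neq0.
have yz : y = z * c by rewrite divfK.
(* [d] is the number of integers strictly between [a] and [b]; the induction is on [d]. *)
pose d := absz (b - a - 1)%R.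
have bd : b = a + d.+1%:Z by rewrite /d; lia.
have -> : \sum_(x <- irange a b) entry_weight c a b x * y ^ x * (c - y) =
  (z ^ a * (v / c) + \sum_(i < d) z ^ (a + i.+1%:Z) * (w + u * c + v / c)
    + z ^ b * (u * c)) * (c - y).
  have om x : entry_weight c a b x * y ^ x = z ^ x * (if x == a then v / c
     else if x == b then u * c else w + u * c + v / c).
    by rewrite /entry_weight /z expfzMl exprz_inv mulrC mulrA.
  rewrite -mulr_suml (eq_bigr _ (fun x _ => om x)) /irange big_map.
  rewrite bd ler_wpDr // (_ : a + d.+1%:Z - a = d.+1); last by rewrite addrAC subrr add0r.
  rewrite absz_nat -[iota 0 d.+2]/(index_iota 0 d.+2) big_nat_recl // big_nat_recr //=.
  rewrite addr0 eqxx addrA; congr ((_ + _ + _) * _).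
    rewrite big_mkord; apply: eq_bigr => i _.
    by rewrite !ifF //; apply/negbTE; have := ltn_ord i; lia.
  by rewrite eqxx ifF //; apply/negbTE; lia.
rewrite -/z bd; elim: d {bd} => [|d IH].
  rewrite big_ord0 addr0 exprzDr ?unitfE // expr1z /pairc.
  by rewrite yz; field.
rewrite big_ord_recr /=.
move: IH; set S := \sum_(i < d) _ => IH.
have zd : z ^ (a + d.+2%:Z) = z ^ (a + d.+1%:Z) * z.
  by rewrite -[in RHS](expr1z z) -exprzDr ?unitfE // -addrA -PoszD addn1.
move: IH; rewrite zd; set T := z ^ (a + _) => IH.
(* Raising [b] by one turns the old right end, of weight [u * c], into an interior entry and adds a
   new right end [T * z * (u * c)]. *)
have -> : (z ^ a * (v / c) + (S + T * (w + u * c + v / c)) + T * z * (u * c)) * (c - y)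
  = (z ^ a * (v / c) + S + T * (u * c)) * (c - y) +
    T * (w + v / c + z * (u * c)) * (c - y) by ring.
by rewrite IH /pairc yz; field.
Qed.

(** Natural indices match those of [strict_sum]; the default 1 keeps the value nonzero at every
    index. *)
Definition yvar n (s : 'S_n) (i : nat) : F :=
  if insub i is Some o then X (s o) else 1.

Lemma yvar_ord n (s : 'S_n) (o : 'I_n) : yvar s o = X (s o).
Proof. by rewrite /yvar valK. Qed.

Lemma yvar_neq0 n (s : 'S_n) i : yvar s i != 0.
Proof. by rewrite /yvar; case: insub => [o|]; rewrite ?X0 ?oner_eq0. Qed.

Lemma yvar_tpermD n (o o' : 'I_n) (s : 'S_n) (i : nat) :
  i != o :> nat -> i != o' :> nat -> yvar (tperm o o' * s)%g i = yvar s i.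
Proof.
move=> io io'; rewrite /yvar; case: insubP => // p _ pi.
by rewrite permM tpermD // -val_eqE /= pi eq_sym.
Qed.

Lemma yvar_tpermL n (o o' : 'I_n) (s : 'S_n) : yvar (tperm o o' * s)%g o = yvar s o'.
Proof. by rewrite !yvar_ord permM tpermL. Qed.

Lemma yvar_tpermR n (o o' : 'I_n) (s : 'S_n) : yvar (tperm o o' * s)%g o' = yvar s o.
Proof. by rewrite !yvar_ord permM tpermR. Qed.

(** Swapping adjacent positions permutes all pairs [p < q] other than [(o, o')] among themselves.
    The statement is cross-multiplied because [pairc] may vanish. *)
Lemma pair_prod_tperm n (o o' : 'I_n) (s : 'S_n) : o' = o.+1 :> nat ->
  pair_prod (tperm o o' * s)%g * pairc (yvar s o) (yvar s o') =
  pair_prod s * pairc (yvar s o') (yvar s o).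
Proof.
move=> eo.
pose rest (t : 'S_n) := \prod_(pq : 'I_n * 'I_n |
   (pq.1 < pq.2)%N && (pq != (o, o'))) pairc (X (t pq.1)) (X (t pq.2)).
have CE t : pair_prod t = pairc (yvar t o) (yvar t o') * rest t.
  by rewrite /pair_prod pair_big_dep /= (bigD1 (o, o')) /=; [rewrite !yvar_ord /rest|rewrite eo ltnS].
have restE : rest (tperm o o' * s)%g = rest s.
  pose f (pq : 'I_n * 'I_n) := (tperm o o' pq.1, tperm o o' pq.2).
  have fK : involutive f by case=> p q; rewrite /f !tpermK.
  rewrite /rest [RHS](reindex_inj (inv_inj fK)) /=; apply: eq_big => [[p q]|[p q] _].
    rewrite /f /= !xpair_eqE -!val_eqE /=.
    by case: tpermP => [->|->|/eqP + /eqP +]; case: tpermP => [->|->|/eqP + /eqP +];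
      rewrite -?val_eqE /=; lia.
  by rewrite /f /= !permM.
rewrite !CE restE yvar_tpermL yvar_tpermR; ring.
Qed.

(** An instance of [asym_expand] at [j = 0]: [P] and [Q] come from [sum_entry_weight], the recursion
    for [Z] from [strict_sum3]. *)
Lemma mt_gen_asym n (k : seq int) : size k = n.+1 -> strict k ->
  let c := X n in
  asym (@pair_prod n) (fun s => strict_sum
     (fun j x => entry_weight c k`_j k`_j.+1 x * yvar s j ^ x * (c - yvar s j)) 0 k) =
  asym (@pair_prod n) (fun s => \sum_(0 <= m < n.+1)
    ((\prod_(0 <= i < m) ((yvar s i / c) ^ k`_i * pairc (yvar s i) c)) *
     \prod_(m <= i < n) - ((yvar s i / c) ^ k`_i.+1 * pairc c (yvar s i)))).
Proof.
move=> sk stk c; have c0 : c != 0 by exact: X0.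
have lek j : (j < n)%N -> k`_j < k`_j.+1.
  by move=> jn; move/(sortedP 0): stk; apply; rewrite sk.
pose phi s j x := entry_weight c k`_j k`_j.+1 x * yvar s j ^ x * (c - yvar s j).
pose P i (s : 'S_n) := (yvar s i / c) ^ k`_i * pairc (yvar s i) c.
pose Q i (s : 'S_n) := (yvar s i / c) ^ k`_i.+1 * pairc c (yvar s i).
pose Z j (s : 'S_n) := strict_sum (phi n s) j (drop j k).
pose h j (s : 'S_n) := Q j s * P j.+1 s + phi n s j k`_j.+1 * phi n s j.+1 k`_j.+1.
(* This is the identity in [a], [b], [c] of the overview. Its only factor not symmetric in the two
   variables is [pairc (yvar s o') (yvar s o)], which [pair_prod_tperm] balances against
   [pair_prod]. *)
have hE (o o' : 'I_n) s : o' = o.+1 :> nat -> h o s = (yvar s o * yvar s o' / (c * c)) ^ k`_o' *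
   (pairc (yvar s o') (yvar s o) * pairc c c).
  move=> eo; rewrite /h /phi /P /Q -eo /entry_weight eqxx.
  have -> : (k`_o' == k`_o) = false.
    by apply/negbTE; rewrite neq_lt eo lek ?orbT // -eo.
  have -> : c ^ (- k`_o') = (c ^ k`_o')^-1 by rewrite invr_expz.
  rewrite !expfzMl !exprz_inv -!invr_expz !expfzMl.
  have := expfz_neq0 k`_o' c0; set C := c ^ _ => C0.
  by rewrite /pairc; field; rewrite ?C0 ?c0.
have := @asym_expand _ n (@pair_prod n) P Q Z h.
pose pre (s : 'S_n) : F := 1.
move=> /(_ _ _ _ _ _ _ _ 0%N pre) E.
transitivity (asym (@pair_prod n) (fun s => pre s * Z 0%N s)).
  by apply: eq_asym => s; rewrite mul1r /Z drop0.
rewrite E //; first by apply: eq_asym => s; rewrite mul1r.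
- by move=> i o o' s _ io io'; rewrite /P yvar_tpermD.
- by move=> i o o' s _ io io'; rewrite /Q yvar_tpermD.
- move=> i o o' s eo o'i; apply: eq_strict_sum => j x ij.
  by rewrite /phi yvar_tpermD //; lia.
- move=> o o' s eo; rewrite !(hE _ _ _ eo) yvar_tpermL yvar_tpermR.
  rewrite (mulrC (yvar s o') (yvar s o)) mulrCA [RHS]mulrCA; congr (_ * _).
  by rewrite !mulrA pair_prod_tperm.
- by move=> s; rewrite /Z (drop_nth 0) ?sk // drop_oversize ?sk // strict_sum1.
- move=> j s jn; rewrite /Z (drop_nth 0) ?sk -?jn // (drop_nth 0) ?sk -?jn //.
  rewrite drop_oversize ?sk -?jn // strict_sum2 sum_entry_weight ?yvar_neq0 //.
  by rewrite lek -?jn.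
- move=> j s jn; rewrite /Z (drop_nth 0) ?sk ?(drop_nth 0 (n := j.+1)) ?sk;
    rewrite ?(drop_nth 0 (n := j.+2)) ?sk; try lia.
  rewrite strict_sum3 ?lek //; try lia.
  rewrite sum_entry_weight ?yvar_neq0 ?lek //; try lia.
  by rewrite /h [Q j s * _ + _]addrC addrK.
Qed.

(** Pairs avoiding the position [m] reproduce [pair_prod s]; the others combine [X n] with some
    [X (s i)], in an order decided by whether [i] lies before [m]. *)
Lemma pair_prod_lift n (m : 'I_n.+1) (s : 'S_n) :
  pair_prod (lift_perm m ord_max s) =
  pair_prod s * \prod_(i < n) (if (i < m)%N then pairc (X (s i)) (X n)
                           else pairc (X n) (X (s i))).
Proof.
have lm (i : 'I_n) : X (lift_perm m ord_max s (lift m i)) = X (s i).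
  by rewrite lift_perm_lift lift_max.
have mm : X (lift_perm m ord_max s m) = X n by rewrite lift_perm_id.
pose g (x y : F) (b : bool) := if b then pairc x y else 1.
have CE k (t : 'S_k) : pair_prod t = \prod_(p < k) \prod_(q < k) g (X (t p)) (X (t q)) (p < q)%N.
  by apply: eq_bigr => p _; rewrite big_mkcond.
have split_m (f : 'I_n.+1 -> F) : \prod_p f p = f m * \prod_(i < n) f (lift m i).
  by rewrite (bigD1_ord m).
have gF x y : g x y false = 1 by [].
rewrite !CE split_m split_m ltnn gF mul1r.
under [X in _ * X]eq_bigr => i _ do rewrite split_m !lm mm.
rewrite big_split mulrA -big_split mulrC /=; congr (_ * _).
  apply: eq_bigr => i _; apply: eq_bigr => j _.
  by rewrite lm; congr g; rewrite /bump; lia.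
apply: eq_bigr => i _; rewrite mm lm /= /g.
have -> : (m < bump m i)%N = ~~ (i < m)%N by rewrite /bump; lia.
have -> : (bump m i < m)%N = (i < m)%N by rewrite /bump; lia.
by case: (i < m)%N; rewrite ?mul1r ?mulr1.
Qed.

(** The summand [m] collects the permutations with [X n] at position [m]: variables before it keep
    the exponent [k i], later ones move up to [k i.+1]. The power of [X n] in front cancels the
    denominators [X n]. *)
Lemma alt_sumS n (k : nat -> int) :
  alt_sum n.+1 k = X n ^ (\sum_(i < n.+1) k i) * asym (@pair_prod n) (fun s =>
   \sum_(0 <= m < n.+1)
    ((\prod_(0 <= i < m) ((yvar s i / X n) ^ k i * pairc (yvar s i) (X n))) *
     \prod_(m <= i < n) - ((yvar s i / X n) ^ k i.+1 * pairc (X n) (yvar s i)))).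
Proof.
rewrite /alt_sum big_lift_perm exchange_big /= mulr_sumr; apply: eq_bigr => s _.
rewrite big_mkord !mulr_sumr; apply: eq_bigr => m _.
have -> : \prod_(p < n.+1) X (lift_perm m ord_max s p) ^ k p =
    X n ^ k m * \prod_(i < n) X (s i) ^ k (lift m i).
  rewrite (bigD1_ord m) //= lift_perm_id /=; congr (_ * _).
  by apply: eq_bigr => i _; rewrite lift_perm_lift lift_max.
rewrite pair_prod_lift odd_lift_perm /=.
have mn : (m <= n)%N by rewrite -ltnS.
rewrite (prod_nat_ltn _ mn) prod_nat_geq.
rewrite (bigD1_ord m) //= expfzDr ?X0 //.
have -> : X n ^ (\sum_(i < n) k (lift m i)) = \prod_(i < n) X n ^ k (lift m i).
  by elim/big_ind2: _ => // x a y b <- <-; rewrite expfzDr ?X0.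
(* The sign of moving [X n] to position [m] is spread as one factor -1 over each of the [n - m]
   later positions, giving the signs of the [Q] factors. *)
have -> : (-1 : F) ^+ (odd m (+) odd n (+) s) =
    (\prod_(i < n) (if (i < m)%N then 1 else -1)) * (-1) ^+ odd_perm s.
  rewrite -(prod_nat_geq n m (fun=> -1)) prodr_const_nat signr_addb; congr (_ * _).
  by rewrite -[RHS]signr_odd oddB // addbC.
transitivity ((-1) ^+ odd_perm s * (pair_prod s * (X n ^ k m * \prod_(i < n)
   ((if (i < m)%N then 1 else -1) * (if (i < m)%N then pairc (X (s i)) (X n)
      else pairc (X n) (X (s i))) * X (s i) ^ k (lift m i))))).
  have e (x y z t a b : F) : x * y * (z * t * (a * b)) = y * (z * (a * (x * t * b))).
    by ring.
  by rewrite [in RHS]big_split [in RHS]big_split e.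
transitivity ((-1) ^+ odd_perm s * (pair_prod s * (X n ^ k m *
   ((\prod_(i < n) X n ^ k (lift m i)) * \prod_(i < n)
     ((if (i < m)%N then (yvar s i / X n) ^ k i * pairc (yvar s i) (X n) else 1) *
      (if (i < m)%N then 1 else
         - ((yvar s i / X n) ^ k i.+1 * pairc (X n) (yvar s i)))))))); last first.
  have e (x y a b p q : F) : x * (y * (a * (b * (p * q)))) = a * b * (x * (y * (p * q))).
    by ring.
  by rewrite [in LHS]big_split e.
rewrite -big_split /=; congr (_ * (_ * (_ * _))); apply: eq_bigr => i _.
rewrite yvar_ord /bump; case: ltnP => im; rewrite ?[(m <= i)%N]leqNgt ?im /= ?add0n ?add1n.
  by rewrite expfzMl exprz_inv -invr_expz; have := expfz_neq0 (k i) (X0 n) => h; field.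
by rewrite expfzMl exprz_inv -invr_expz; have := expfz_neq0 (k i.+1) (X0 n) => h; field.
Qed.

(** In the induction, the factors [X n - X i] by which [vander n.+1] exceeds [vander n] are
    distributed over the entries of the row above. This is the form required by [mt_gen_asym], and
    [alt_sumS] recognizes the result. *)
Theorem mt_gen_bialternant n (k : seq int) : size k = n -> strict k ->
  mt_gen n k * vander n = alt_sum n (nth 0 k).
Proof.
elim: n k => [|n IH] k sk stk.
  rewrite /mt_gen /= /vander /alt_sum big_ord0 mul1r (bigD1 1%g) //= [X in _ + X]big1 => [|s /eqP h].
    by rewrite addr0 odd_perm1 /pair_prod !big_ord0 !mulr1.
  by case: h; apply/permP => - [].
rewrite alt_sumS -mt_gen_asym // /mt_gen /= -/mt_gen big_filter /vander big_ord_recr /= -/(vander n).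
have -> : \sum_(i < n.+1) k`_i = \sum_(x <- k) x.
  by rewrite [RHS](big_nth 0) sk big_mkord.
rewrite mulr_suml /asym.
under [X in _ = _ * X]eq_bigr => s _ do rewrite /strict_sum mulrA mulr_sumr.
rewrite [X in _ = _ * X]exchange_big /= mulr_sumr; rewrite big_seq_cond [RHS]big_seq_cond.
apply: eq_bigr => l /andP[hl stl].
have k0 : k != [::] by case: (k) sk.
have [sl _] := elimT (mem_inter l k0) hl.
move: sl; rewrite sk => -[/esym sl].
transitivity (step_weight (X n) k l * (mt_gen n l * vander n) *
              \prod_(i < n) (X n - X i)); first by ring.
rewrite IH // /alt_sum /step_weight -!mulrA; congr (_ * _).
rewrite mulr_suml mulr_sumr; apply: eq_bigr => s _.
(* The product is symmetric, so for each [s] the factor given to entry [i] can be the one with the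
   variable [X (s i)]. *)
have -> : \prod_(i < n) (X n - X i) = \prod_(i < n) (X n - X (s i)).
  by rewrite (reindex_inj (@perm_inj _ s)).
rewrite !wprodE sl !big_split /=.
have e (a b x y z t : F) : a * b * (x * (y * z) * t) = x * y * (a * b * z * t) by ring.
rewrite e; congr (_ * (_ * _ * _)).
  by apply: eq_bigr => i _; rewrite yvar_ord.
by apply: eq_bigr => i _; rewrite yvar_ord.
Qed.

End Bialternant.

(** * Monotone triangles *)

Section FunToSeq.
Variable n : nat.

Definition fseq (k : 'I_n -> int) : seq int := [seq k i | i <- enum 'I_n].

Lemma size_fseq k : size (fseq k) = n.
Proof. by rewrite size_map size_enum_ord. Qed.

Lemma nth_fseq k (i : 'I_n) : (fseq k)`_i = k i.
Proof. by rewrite (nth_map i) ?size_enum_ord // nth_ord_enum. Qed.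

Lemma strict_fseq (k : 'I_n -> int) :
  (forall i j : 'I_n, (i < j)%N -> k i < k j) -> strict (fseq k).
Proof.
move=> hk; apply/(sortedP 0) => i; rewrite size_fseq => hi.
by have := hk (Ordinal (ltnW hi)) (Ordinal hi) (leqnn _); rewrite -!nth_fseq.
Qed.

Lemma has_bottom_rowE k m : has_bottom_row k m = (tri_row m n == fseq k).
Proof.
apply/forallP/eqP => [h|h j]; last by rewrite -nth_fseq -h nth_tri_row.
apply: (@eq_from_nth _ 0); rewrite ?size_fseq ?size_tri_row // => i hi.
by rewrite nth_tri_row // (eqP (h (Ordinal hi))) -nth_fseq.
Qed.

Lemma all_fseq k (p : pred int) : all p (fseq k) = [forall i, p (k i)].
Proof.
rewrite all_map; apply/allP/forallP => h i; last by move=> _; exact: h.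
by apply: h; rewrite mem_enum.
Qed.

(** The default 1 keeps the extended family nonzero, as the bialternant section requires of all its
    variables. *)
Definition extend (R : pzSemiRingType) (X : 'I_n -> R) (i : nat) : R :=
  if insub i is Some o then X o else 1.

Lemma extendE (R : pzSemiRingType) (X : 'I_n -> R) (i : 'I_n) : extend X i = X i.
Proof. by rewrite /extend valK. Qed.

Lemma fseq_bound k : all (fun x : int => `|x| <= (\sum_(i < n) absz (k i))%N%:Z) (fseq k).
Proof.
rewrite all_fseq; apply/forallP => i.
by rewrite (bigD1 i) //= PoszD abszE lerDl.
Qed.
End FunToSeq.

Lemma mem_mt_next (k l : seq int) : k != [::] ->
  reflect [/\ size k = (size l).+1,
           forall i, (i < size l)%N -> k`_i <= l`_i <= k`_i.+1 & strict l]
          (l \in mt_next k).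
Proof.
move=> k0; rewrite mem_filter.
by apply: (iffP andP) => [[sl /(mem_inter _ k0)[]]|[h1 h2 h3]]; split=> //;
  apply/(mem_inter _ k0).
Qed.

Lemma mt_next_uniq k : uniq (mt_next k).
Proof. by rewrite filter_uniq ?inter_uniq. Qed.

Lemma size_mt_next (k l : seq int) : k != [::] -> l \in mt_next k -> size k = (size l).+1.
Proof. by move=> k0 /(mem_mt_next _ k0)[]. Qed.

Lemma mt_next_bound (S : int) (k l : seq int) : k != [::] -> l \in mt_next k ->
  all (fun x : int => `|x| <= S) k -> all (fun x : int => `|x| <= S) l.
Proof.
move=> k0 /(mem_mt_next _ k0)[sk hk _] /(all_nthP 0) h.
have between (a b x : int) : a <= x <= b -> `|a| <= S -> `|b| <= S -> `|x| <= S by lia.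
by apply/(all_nthP 0) => i hi; apply: between (hk i hi) _ _; apply: h; rewrite sk ltnS // ltnW.
Qed.

Lemma strict_tri_row m i :
  strict (tri_row m i) = all (fun j => m i j < m i j.+1) (iota 1 i.-1).
Proof.
apply/(sortedP 0)/allP => [h j|h j]; rewrite ?mem_iota ?size_tri_row => hj.
  by have := h j.-1; rewrite size_tri_row !nth_tri_row ?prednK; try lia; apply; lia.
by rewrite !nth_tri_row //; [apply: h; rewrite mem_iota; lia | lia].
Qed.

(** A chain forces strictness only of the rows above the bottom one; that of the bottom row comes
    from the hypothesis on [k]. *)
Lemma monotone_triangleE n (k : 'I_n -> int) m : strict (fseq k) ->
  is_monotone_triangle n m && has_bottom_row k m =
  (tri_row m n == fseq k) && chain mt_next n m.
Proof.
move=> sk; rewrite has_bottom_rowE andbC; case: eqP => //= e.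
have row0 i : tri_row m i.+1 != [::] by rewrite -size_eq0 size_tri_row.
apply/andP/allP => [[/allP h1 /allP h2] i|h].
  rewrite mem_iota => /andP[_ hi]; apply/(mem_mt_next _ (row0 i)).
  rewrite !size_tri_row; split=> // [j hj|].
    have /h1/allP : i \in iota 1 n.-1 by rewrite mem_iota; lia.
    move=> /(_ j.+1); rewrite mem_iota !nth_tri_row //; first by apply; lia.
    exact: ltnW.
  case: i hi => [|i] hi //; rewrite strict_tri_row; apply: h2.
  by rewrite mem_iota; lia.
split; apply/allP => i; rewrite mem_iota => hi.
  have /h/(mem_mt_next _ (row0 i))[_ hh _] : i \in iota 0 n by rewrite mem_iota; lia.
  apply/allP => j; rewrite mem_iota => hj.
  have ji : (j.-1 < i)%N by lia.
  have := hh j.-1; rewrite size_tri_row => /(_ ji).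
  by rewrite !nth_tri_row ?prednK //; lia.
rewrite -strict_tri_row; have [->|ni] := eqVneq i n; first by rewrite e.
have /h : i \in iota 0 n by rewrite mem_iota; lia.
by case/(mem_mt_next _ (row0 i)).
Qed.

Lemma exp_count (R : comPzSemiRingType) (T : Type) (x : R) (p : pred T) s :
  x ^+ count p s = \prod_(j <- s) (if p j then x else 1).
Proof.
elim: s => [|a s IH] /=; first by rewrite big_nil.
by rewrite big_cons -IH; case: (p a); rewrite ?mul1r // exprS.
Qed.

Lemma chain_next next n m i : chain next n m -> (i < n)%N ->
  tri_row m i \in next (tri_row m i.+1).
Proof. by move=> /allP h hi; apply: h; rewrite mem_iota. Qed.

(** * The weight of a monotone triangle as a product over consecutive rows *)

Section MTWeight.
Variables (F : fieldType) (u v w : F).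

Lemma exprz_sum (x : F) (I : Type) (s : seq I) (f : I -> int) : x != 0 ->
  x ^ (\sum_(i <- s) f i) = \prod_(i <- s) x ^ f i.
Proof. by move=> x0; elim/big_ind2: _ => // a p b q <- <-; rewrite expfzDr. Qed.

(** Both sides are products over the entries of row [i]. Strictness of row [i.+1] rules out an entry
    that leans both ways, so each entry is counted exactly once. *)
Lemma step_weight_cnt n m i (c : F) : c != 0 -> (i < n)%N ->
  tri_row m i \in mt_next (tri_row m i.+1) -> strict (tri_row m i.+1) ->
  step_weight u v w c (tri_row m i.+1) (tri_row m i) =
  u ^+ r_cnt n m i * v ^+ l_cnt n m i * (c ^ d_exp n m i.+1 *
     (w + u * c + v * c^-1) ^+ s_cnt n m i).
Proof.
move=> c0 hi; have row0 : tri_row m i.+1 != [::] by rewrite -size_eq0 size_tri_row.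
case/(mem_mt_next _ row0) => _; rewrite size_tri_row => hh _ st.
rewrite /step_weight /d_exp /r_cnt /l_cnt /s_cnt /= hi.
rewrite !expfzDr // -!invr_expz.
rewrite -[c ^ Posz _]/(c ^+ _) -[c ^ Posz _]/(c ^+ _).
have -> : \sum_(x <- tri_row m i.+1) x = \sum_(1 <= j < i.+2) m i.+1 j.
  by rewrite big_map big_add1.
set K := c ^ _.
suff -> : wprod (fun j => entry_weight u v w c (tri_row m i.+1)`_j (tri_row m i.+1)`_j.+1) 0 (tri_row m i) =
   u ^+ count (fun j => m i j == m i.+1 j.+1) (iota 1 i) *
   v ^+ count (fun j => m i j == m i.+1 j) (iota 1 i) *
   ((c ^ (\sum_(1 <= j < i.+1) m i j))^-1 *
    c ^+ count (fun j => m i j == m i.+1 j.+1) (iota 1 i) *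
    (c ^+ count (fun j => m i j == m i.+1 j) (iota 1 i))^-1 *
    (w + u * c + v * c^-1) ^+ count (fun j => (m i.+1 j < m i j) && (m i j < m i.+1 j.+1)) (iota 1 i)).
  rewrite !mulrA; do 4 congr (_ * _); rewrite -!mulrA; ring.
have -> : wprod (fun j => entry_weight u v w c (tri_row m i.+1)`_j (tri_row m i.+1)`_j.+1) 0 (tri_row m i)
    = \prod_(j < i) entry_weight u v w c (m i.+1 j.+1) (m i.+1 j.+2) (m i j.+1).
  rewrite wprodE size_tri_row; apply: eq_bigr => j _.
  by rewrite add0n !nth_tri_row ?ltnS ?(ltnW (ltn_ord j)).
rewrite -!exprVn invr_expz -sumrN exprz_sum // !exp_count.
have -> : iota 1 i = index_iota 1 i.+1 by rewrite /index_iota subn1.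
rewrite -!big_split /= big_add1 /= big_mkord.
apply: eq_bigr => j _; rewrite /entry_weight.
have := hh j (ltn_ord j); rewrite !nth_tri_row ?ltnS ?(ltnW (ltn_ord j)) // => /andP[h1 h2].
have hk : m i.+1 j.+1 < m i.+1 j.+2.
  by have := (sortedP 0 st) j; rewrite size_tri_row ltnS !nth_tri_row ?ltnS ?(ltnW (ltn_ord j)) //; apply.
have [e|ne] := eqVneq (m i j.+1) (m i.+1 j.+1).
  rewrite -e ltxx /= !mulr1; case: eqP => [e2|_]; first by move: hk; rewrite -e -e2 ltxx.
  by rewrite !mul1r mulr1 mulrCA.
have -> : m i.+1 j.+1 < m i j.+1 by rewrite lt_neqAle eq_sym ne.
rewrite /= lt_neqAle h2 andbT.
by case: eqVneq => [e2|ne2] /=; rewrite ?mulr1 ?mul1r //; rewrite mulrCA.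
Qed.

Lemma MT_sum_gen n (X : 'I_n -> F) (k : 'I_n -> int) :
  (forall i, X i != 0) -> strict (fseq k) ->
  MT_sum u v w X k = mt_gen u v w (extend X) n (fseq k).
Proof.
move=> X0 sk; apply: tri_sum_rec.
- exact: mt_next_uniq.
- exact: size_mt_next.
- exact: size_fseq.
- by move=> m; exact: monotone_triangleE.
- move=> m; rewrite monotone_triangleE // => /andP[/eqP em hc].
  rewrite /W0.
  (* Row 0 has no entries, so starting the sum at 0 instead of 1 changes nothing. *)
  have -> : r_tot n m = (\sum_(i < n) r_cnt n m i)%N.
    rewrite /r_tot -(big_mkord xpredT); case: (n) => [|n']; first by rewrite !big_geq.
    by rewrite [RHS]big_ltn //= {2}/r_cnt.
  have -> : l_tot n m = (\sum_(i < n) l_cnt n m i)%N.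
    rewrite /l_tot -(big_mkord xpredT); case: (n) => [|n']; first by rewrite !big_geq.
    by rewrite [RHS]big_ltn //= {2}/l_cnt.
  rewrite -!prodrXr -!big_split /=; apply: eq_bigr => i _.
  rewrite extendE (@step_weight_cnt n) //; first exact: chain_next hc (ltn_ord i).
  have [ein|nin] := eqVneq i.+1 n; first by rewrite ein em.
  have hi : (i.+1 < n)%N by rewrite ltn_neqAle nin ltn_ord.
  have row0 : tri_row m i.+2 != [::] by rewrite -size_eq0 size_tri_row.
  by have /(mem_mt_next _ row0)[] := chain_next hc hi.
move=> t l x ht hl hx.
have := tris_all size_mt_next (@mt_next_bound _) (size_fseq k) (fseq_bound k) ht.
by move=> /allP/(_ _ hl)/allP/(_ _ hx).
Qed.
End MTWeight.

(** * Extended Schur polynomials *)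

(* Reversing a weakly decreasing sequence and adding (0, 1, 2, ...) makes it  *)
(* strictly increasing and turns Gelfand-Tsetlin patterns into monotone       *)
(* triangles without right-leaning entries.                                   *)
Definition rev_shift (l : seq int) : seq int :=
  mkseq (fun j => l`_(size l - j.+1) + j%:Z) (size l).
Definition unrev_shift (l : seq int) : seq int :=
  mkseq (fun j => l`_(size l - j.+1) - (size l - j.+1)%N%:Z) (size l).

Lemma size_rev_shift l : size (rev_shift l) = size l.
Proof. exact: size_mkseq. Qed.

Lemma size_unrev_shift l : size (unrev_shift l) = size l.
Proof. exact: size_mkseq. Qed.

Lemma nth_rev_shift l j : (j < size l)%N ->
  (rev_shift l)`_j = l`_(size l - j.+1) + j%:Z.
Proof. by move=> hj; rewrite nth_mkseq. Qed.

Lemma rev_shiftK : cancel rev_shift unrev_shift.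
Proof.
move=> l; apply: (@eq_from_nth _ 0); rewrite size_unrev_shift size_rev_shift // => j hj.
rewrite nth_mkseq ?size_rev_shift // nth_rev_shift ?size_rev_shift; last by lia.
by rewrite addrK; congr (_ `_ _); lia.
Qed.

Lemma unrev_shiftK : cancel unrev_shift rev_shift.
Proof.
move=> l; apply: (@eq_from_nth _ 0); rewrite size_rev_shift size_unrev_shift // => j hj.
rewrite nth_rev_shift ?size_unrev_shift // nth_mkseq; last by lia.
have -> : (size l - (size l - j.+1).+1)%N = j by lia.
by rewrite subrK.
Qed.

Lemma sum_rev_shift l :
  \sum_(x <- rev_shift l) x = \sum_(x <- l) x + \sum_(j < size l) j%:Z.
Proof.
rewrite big_map -{1}[size l]subn0 -/(index_iota 0 _) big_mkord big_split /=; congr (_ + _).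
rewrite [RHS](big_nth 0) big_mkord (reindex_inj rev_ord_inj) /=.
by apply: eq_bigr => i _; congr (_ `_ _); have := ltn_ord i; lia.
Qed.

Definition no_right (k l : seq int) := all (fun j => l`_j < k`_j.+1) (iota 0 (size l)).

(** Defining the rows as images of monotone-triangle rows lets sums over patterns be transported by
    a map; [mem_gt_next] recovers the usual interlacing. *)
Definition gt_next (k : seq int) : seq (seq int) :=
  [seq unrev_shift l | l <- [seq l <- mt_next (rev_shift k) | no_right (rev_shift k) l]].

Lemma gt_next_uniq k : uniq (gt_next k).
Proof.
by rewrite map_inj_uniq ?filter_uniq ?inter_uniq //; exact: can_inj unrev_shiftK.
Qed.

(** After reversal and shift, the condition reads [k'_i <= l'_i < k'_(i+1)]: the upper neighbour is
    shifted by one more than the entry. Strictness of the shifted row then follows. *)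
Lemma mem_gt_next (k l : seq int) : k != [::] ->
  reflect (size k = (size l).+1 /\
           forall a, (a < size l)%N -> k`_a.+1 <= l`_a <= k`_a)
          (l \in gt_next k).
Proof.
move=> k0; have k0' : rev_shift k != [::] by rewrite -size_eq0 size_rev_shift size_eq0.
rewrite -[l in X in reflect _ X]rev_shiftK (mem_map (can_inj unrev_shiftK)) mem_filter.
have step (sk : size k = (size l).+1) a : (a < size l)%N ->
    [/\ (rev_shift l)`_(size l - a.+1) = l`_a + (size l - a.+1)%N%:Z,
        (rev_shift k)`_(size l - a.+1) = k`_a.+1 + (size l - a.+1)%N%:Z &
        (rev_shift k)`_(size l - a.+1).+1 = k`_a + (size l - a.+1)%N.+1%:Z].
  by move=> ha; rewrite !nth_rev_shift ?sk; try lia; split; congr (_`_ _ + _); lia.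
have rv a : (a < size l)%N -> (size l - (size l - a.+1).+1)%N = a by lia.
apply: (iffP andP) => [[/allP hr /(mem_mt_next _ k0')[]]|[sk hk]].
  rewrite !size_rev_shift => sk hl _; split=> // a ha.
  have [e1 e2 e3] := step sk a ha.
  have ia : (size l - a.+1 < size l)%N by lia.
  have := hr (size l - a.+1)%N; rewrite mem_iota size_rev_shift e1 e3 => /(_ ia).
  have := hl _ ia; rewrite e1 e2; lia.
have hl i : (i < size l)%N ->
    (rev_shift k)`_i <= (rev_shift l)`_i < (rev_shift k)`_i.+1.
  move=> hi; have ia : (size l - i.+1 < size l)%N by lia.
  have [] := step sk _ ia; rewrite (rv _ hi) => -> -> ->.
  by have := hk _ ia; lia.
split; first by apply/allP => i; rewrite mem_iota size_rev_shift => /hl/andP[].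
apply/(mem_mt_next _ k0'); rewrite !size_rev_shift; split=> // [i /hl/andP[-> /ltW]//|].
apply/(sortedP 0) => i; rewrite size_rev_shift => hi.
have /andP[_ h1] := hl i (ltnW hi); have /andP[h2 _] := hl _ hi.
exact: lt_le_trans h1 h2.
Qed.

Lemma size_gt_next (k l : seq int) : k != [::] -> l \in gt_next k -> size k = (size l).+1.
Proof. by move=> k0 /(mem_gt_next _ k0)[]. Qed.

Lemma gt_next_bound (S : int) (k l : seq int) : k != [::] -> l \in gt_next k ->
  all (fun x : int => `|x| <= S) k -> all (fun x : int => `|x| <= S) l.
Proof.
move=> k0 /(mem_gt_next _ k0)[sk hk] /(all_nthP 0) h.
have between (a b x : int) : a <= x <= b -> `|a| <= S -> `|b| <= S -> `|x| <= S by lia.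
by apply/(all_nthP 0) => i hi; apply: between (hk i hi) _ _; apply: h; rewrite sk ltnS // ltnW.
Qed.

Lemma GT_patternE n (mu : 'I_n -> int) g :
  is_GT_pattern n g && has_bottom_row mu g =
  (tri_row g n == fseq mu) && chain gt_next n g.
Proof.
rewrite has_bottom_rowE andbC; case: eqP => //= e.
have row0 i : tri_row g i.+1 != [::] by rewrite -size_eq0 size_tri_row.
apply/allP/allP => [h i|h i]; rewrite mem_iota => hi.
  apply/(mem_gt_next _ (row0 i)); rewrite !size_tri_row; split=> // a ha.
  have /h/allP : i \in iota 1 n.-1 by rewrite mem_iota; lia.
  move=> /(_ a.+1); rewrite mem_iota !nth_tri_row //; first by apply; lia.
  exact: ltnW.
have /h/(mem_gt_next _ (row0 i))[_ hh] : i \in iota 0 n by rewrite mem_iota; lia.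
apply/allP => j; rewrite mem_iota => hj.
have ji : (j.-1 < i)%N by lia.
have := hh j.-1; rewrite size_tri_row => /(_ ji).
by rewrite !nth_tri_row ?prednK //; lia.
Qed.

Section Schur.
Variables (F : fieldType) (n : nat) (X : 'I_n -> F).
Hypothesis X0 : forall i, X i != 0.
Notation X' := (extend X).

Lemma extend_neq0 i : X' i != 0.
Proof. by rewrite /extend; case: insub => [o|]; rewrite ?X0 ?oner_eq0. Qed.

Definition gt_wt i (k l : seq int) : F := X' i ^ (\sum_(x <- k) x - \sum_(x <- l) x).

Lemma schur_rec mu : schur X mu = rec_sum gt_next gt_wt n (fseq mu).
Proof.
apply: tri_sum_rec.
- exact: gt_next_uniq.
- exact: size_gt_next.
- exact: size_fseq.
- by move=> g; exact: GT_patternE.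
- move=> g _; apply: eq_bigr => i _.
  by rewrite /gt_wt extendE !big_map !big_add1 /= /index_iota !subn0.
move=> t l x ht hl hx.
have := tris_all size_gt_next (@gt_next_bound _) (size_fseq mu) (fseq_bound mu) ht.
by move=> /allP/(_ _ hl)/allP/(_ _ hx).
Qed.

(** A right-leaning entry has weight [u * c = 0], any other entry [x] has weight [c ^ (- x - 1)].
    The [i] extra factors [c ^ (- 1)] account for the difference between the total shifts of the two
    rows. *)
Lemma step_weight010 i (k l : seq int) : size k = i.+1 -> strict (rev_shift k) ->
  l \in mt_next (rev_shift k) ->
  step_weight 0 1 0 (X' i) (rev_shift k) l =
  if no_right (rev_shift k) l then gt_wt i k (unrev_shift l) else 0.
Proof.
move=> sk st; have k0 : rev_shift k != [::] by rewrite -size_eq0 size_rev_shift sk.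
case/(mem_mt_next _ k0); rewrite size_rev_shift sk => -[sl] hl _.
have c0 := extend_neq0 i; set c := X' i in c0 *.
rewrite /step_weight wprodE -sl.
have [/allP hr|/allPn[j]] := boolP (no_right _ _); last first.
  rewrite mem_iota -sl /= => hj; rewrite -leNgt => hr.
  have hlj := hl j; rewrite -sl in hlj.
  have e : l`_j = (rev_shift k)`_j.+1.
    by apply/eqP; rewrite eq_le hr andbT; case/andP: (hlj hj).
  have lt : (rev_shift k)`_j < (rev_shift k)`_j.+1.
    by apply: (sortedP 0 st); rewrite size_rev_shift sk.
  rewrite (bigD1 (Ordinal hj)) //= add0n /entry_weight e eqxx gt_eqF // mul0r mulr0.
  by rewrite mul0r mulr0.
rewrite (eq_bigr (fun j : 'I_i => c ^ (- l`_j) * c ^ (- 1))); last first.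
  move=> j _; rewrite add0n /entry_weight; congr (_ * _).
  have := hr j; rewrite mem_iota -sl ltn_ord => /(_ isT) h.
  rewrite [l`_j == (rev_shift k)`_j.+1]lt_eqF // mul0r !add0r div1r if_same.
  by rewrite exprN1.
rewrite /gt_wt -/c big_split /= -!exprz_sum // -!expfzDr //; congr (_ ^ _).
have := sum_rev_shift (unrev_shift l); rewrite unrev_shiftK size_unrev_shift -sl.
rewrite sum_rev_shift sk [\sum_(j < i.+1) _]big_ord_recr /= !sumrN [\sum_(x <- l) x](big_nth 0) -sl big_mkord.
by rewrite sumr_const card_ord => ->; rewrite natz; ring.
Qed.

Lemma rec_sum_gt i k : size k = i -> strict (rev_shift k) ->
  rec_sum gt_next gt_wt i k = mt_gen 0 1 0 X' i (rev_shift k).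
Proof.
elim: i k => [|i IH] k sk st; first by [].
rewrite /mt_gen /= -/(mt_gen 0 1 0 X') big_map big_filter big_mkcond.
apply: eq_big_seq => l hl; rewrite step_weight010 //.
case: ifP => hr; last by rewrite mul0r.
have k0 : rev_shift k != [::] by rewrite -size_eq0 size_rev_shift sk.
case/(mem_mt_next _ k0): hl; rewrite size_rev_shift sk => -[sl] _ stl.
by rewrite IH ?unrev_shiftK ?size_unrev_shift.
Qed.

Definition alternant (e : 'I_n -> int) : F := \det (\matrix_(p, q) X q ^ e p).

Lemma alt_sum010 (e : nat -> int) : alt_sum 0 1 0 X' n e = alternant (fun p => e p).
Proof.
apply: eq_bigr => s _; congr (_ * _).
rewrite /pair_prod big1 ?mul1r => [|p _]; last first.
  by rewrite big1 // => q _; rewrite /pairc !mul0r add0r addr0.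
by apply: eq_bigr => p _; rewrite mxE extendE.
Qed.

(** The bialternant formula, with the exponents listed in increasing order to match the sign of
    [vander]. *)
Lemma schur_alternant mu : strict (rev_shift (fseq mu)) ->
  schur X mu * vander X' n = alternant (fun p => mu (rev_ord p) + p%:Z).
Proof.
move=> st; rewrite schur_rec rec_sum_gt ?size_fseq //.
rewrite mt_gen_bialternant ?size_rev_shift ?size_fseq //; last exact: extend_neq0.
rewrite alt_sum010; congr (\det _); apply/matrixP => p q; rewrite !mxE; congr (_ ^ _).
by rewrite nth_rev_shift size_fseq // -nth_fseq.
Qed.

Lemma alternant_eq0 e (p q : 'I_n) : p != q -> e p = e q -> alternant e = 0.
Proof. by move=> pq epq; apply: (determinant_alternate pq) => j; rewrite !mxE epq. Qed.

Lemma alternant_perm e (s : 'S_n) :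
  alternant (fun p => e (s p)) = (-1) ^+ odd_perm s * alternant e.
Proof.
rewrite -det_perm -det_mulmx -row_permE; congr (\det _).
by apply/matrixP => p q; rewrite !mxE.
Qed.

Lemma alternant_shift e (c : int) :
  alternant (fun p => e p + c) = alternant e * \prod_(i < n) X i ^ c.
Proof.
transitivity (\det ((\matrix_(p, q) X q ^ e p) *m diag_mx (\row_q X q ^ c))).
  congr (\det _); apply/matrixP => p q; rewrite mul_mx_diag !mxE expfzDr //.
by rewrite det_mulmx det_diag; congr (_ * _); apply: eq_bigr => i _; rewrite mxE.
Qed.

(** This shows that the [pick] in [schur_ext] succeeds when the numbers [lam i - i] are distinct. *)
Lemma decreasing_perm (a : 'I_n -> int) : injective a ->
  exists s : 'S_n, forall i j : 'I_n, (i < j)%N -> a (s j) < a (s i).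
Proof.
move=> a_inj; pose r (i j : 'I_n) := a j <= a i.
pose t := sort r (enum 'I_n).
have st : size t = n by rewrite size_sort size_enum_ord.
have ut : uniq t by rewrite sort_uniq enum_uniq.
have s_inj : injective (fun i : 'I_n => nth i t i).
  move=> i j; rewrite [nth i t i](set_nth_default j) ?st // => /eqP.
  by rewrite nth_uniq ?st // => /eqP/val_inj.
exists (perm s_inj) => i j ij; rewrite !permE.
rewrite lt_neqAle (inj_eq a_inj) [nth i t i](set_nth_default j) ?st //.
rewrite nth_uniq ?st // gt_eqF //=.
have r_tr : transitive r by move=> x y z h1 h2; exact: le_trans h2 h1.
have r_tot : total r by move=> x y; exact: le_total.
by apply: (sorted_ltn_nth r_tr _ (sort_sorted r_tot _)); rewrite ?inE ?st.
Qed.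

(** The bialternant formula persists for all integer vectors: two equal values [lam i - i] give two
    equal rows, sorting produces the sign, and the translation by [p] cancels against the monomial
    factor. *)
Lemma schur_ext_alternant lam :
  schur_ext X lam * vander X' n = alternant (fun p => lam (rev_ord p) + p%:Z).
Proof.
rewrite /schur_ext; case: existsP => [[i /existsP[j /andP[ij /eqP e]]]|hn].
  rewrite mul0r (@alternant_eq0 _ (rev_ord i) (rev_ord j)) //.
    by rewrite (inj_eq rev_ord_inj) -val_eqE /= ltn_eqF.
  by rewrite !rev_ordK /=; have := ltn_ord i; have := ltn_ord j; lia.
have a_inj : injective (fun i : 'I_n => lam i - (i : nat)%:Z).
  move=> i j e; apply/val_inj; case: (ltngtP i j) => // ij; case: hn.
    by exists i; apply/existsP; exists j; rewrite ij e eqxx.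
  by exists j; apply/existsP; exists i; rewrite ij e eqxx.
case: pickP => [s /forallP hs|h0]; last first.
  have [s hs] := decreasing_perm a_inj.
  by have /forallP[] := h0 s; move=> i; apply/forallP => j; apply/implyP => /hs.
set p : int := Posz _ => /=.
set mu := (fun i : 'I_n => _).
pose r : 'S_n := perm rev_ord_inj.
pose e (q : 'I_n) := lam (rev_ord q) + q%:Z.
(* The alternant lists the exponents in reverse order, so [s] acts on them through its conjugate by
   the reversal [r], which has the same sign. *)
have mE (q : 'I_n) : mu (rev_ord q) + q%:Z = e ((r * s * r)%g q) + p.
  rewrite /mu /e !permM !permE rev_ordK /=.
  by have := ltn_ord q; have := ltn_ord (s (rev_ord q)); lia.
rewrite mulrAC -[_ * schur X mu * _]mulrA schur_alternant.
  have -> : alternant (fun q => mu (rev_ord q) + q%:Z) =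
      alternant (fun q => e ((r * s * r)%g q) + p).
    by congr (\det _); apply/matrixP => a b; rewrite !mxE mE.
  rewrite alternant_shift alternant_perm -!mulrA mulrA -signr_addb.
  have -> : odd_perm s (+) odd_perm (r * s * r)%g = false.
    by rewrite !odd_permM; case: (odd_perm s); case: (odd_perm r).
  rewrite mul1r -big_split big1 /= ?mulr1 // => i _.
  by rewrite -expfzDr // subrr.
apply/(sortedP 0) => q; rewrite size_rev_shift size_fseq => hq.
rewrite !nth_rev_shift ?size_fseq ?(ltnW hq) //.
pose q0 := Ordinal (ltnW hq); pose q1 := Ordinal hq.
have -> : (fseq mu)`_(n - q.+1) = mu (rev_ord q0) by rewrite -nth_fseq.
have -> : (fseq mu)`_(n - q.+2) = mu (rev_ord q1) by rewrite -nth_fseq.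
have /forallP/(_ (rev_ord q0))/implyP := hs (rev_ord q1).
rewrite /mu /=; have h : (n - q.+2 < n - q.+1)%N by lia.
by move=> /(_ h); lia.
Qed.
End Schur.

(** * Shift operators and specialization *)

Section Symbol.
Variables (F : fieldType) (n : nat).
Implicit Types (L : shift_op F n) (x : 'I_n -> F).

(** The Laurent polynomial obtained by substituting [x p] for the shift in [k p], that is, the
    eigenvalue of [L] on the product of the powers [x p ^ k p]. *)
Definition symbol L x : F := \sum_(t <- L) t.1 * \prod_(p < n) x p ^ t.2 p.

Lemma symbol_mul L1 L2 x : (forall i, x i != 0) ->
  symbol (op_mul L1 L2) x = symbol L1 x * symbol L2 x.
Proof.
move=> x0; rewrite /symbol big_allpairs_dep /= mulr_suml.
apply: eq_bigr => t1 _; rewrite mulr_sumr; apply: eq_bigr => t2 _ /=.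
rewrite mulrACA -big_split; congr (_ * _); apply: eq_bigr => p _.
by rewrite expfzDr.
Qed.

Lemma symbol_pair u v w x (p q : 'I_n) : (forall i, x i != 0) -> p != q ->
  symbol (pair_factor u v w p q) x = u * x p + v / x q + w * (x p / x q).
Proof.
move=> x0 pq.
have prod1 (i : 'I_n) : \prod_(j < n) x j ^ unitv i j = x i.
  rewrite (bigD1 i) //= /unitv eqxx big1 ?mulr1 // => j /negbTE -> //.
have prodV (i : 'I_n) : \prod_(j < n) x j ^ (- unitv i j) = (x i)^-1.
  rewrite (bigD1 i) //= /unitv eqxx big1 ?mulr1 ?exprN1 // => j /negbTE -> //.
rewrite /symbol !big_cons big_nil /= prod1 prodV addr0 addrA.
congr (_ + _ * _); rewrite -[x p in RHS]prod1 -[(x q)^-1]prodV -big_split.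
by apply: eq_bigr => j _; rewrite expfzDr.
Qed.

Lemma symbol_op_prod u v w x : (forall i, x i != 0) ->
  symbol (op_prod n u v w) x =
  \prod_(p < n) \prod_(q < n | (p < q)%N) (u * x p + v / x q + w * (x p / x q)).
Proof.
move=> x0; transitivity (\prod_(pq <- ord_pairs n) symbol (pair_factor u v w pq.1 pq.2) x).
  rewrite /op_prod; elim: (ord_pairs n) => [|pq s IH] /=.
    by rewrite big_nil /symbol big_cons big_nil /= addr0 mul1r big1.
  by rewrite big_cons symbol_mul // IH.
rewrite /ord_pairs big_flatten big_map big_enum /=; apply: eq_bigr => p _.
rewrite big_map big_filter big_enum_cond /=; apply: eq_bigr => q pq.
by rewrite symbol_pair // -val_eqE /= ltn_eqF.
Qed.

(** Each pair [p < q] receives one factor [x q], which clears its denominators; [x q] is thus used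
    [q] times. *)
Lemma prod_shift_pairc u v w x : (forall i, x i != 0) ->
  (\prod_(p < n) x p ^+ p) *
  (\prod_(p < n) \prod_(q < n | (p < q)%N) (u * x p + v / x q + w * (x p / x q))) =
  \prod_(p < n) \prod_(q < n | (p < q)%N) pairc u v w (x p) (x q).
Proof.
move=> x0.
have -> : \prod_(p < n) x p ^+ p = \prod_(p < n) \prod_(q < n | (p < q)%N) x q.
  rewrite (exchange_big_dep xpredT) //=; apply: eq_bigr => q _.
  by rewrite -(big_ord_widen n (fun=> x q)) ?prodr_const ?card_ord // ltnW.
rewrite -big_split; apply: eq_bigr => p _; rewrite -big_split.
by apply: eq_bigr => q _ /=; rewrite /pairc; field.
Qed.
End Symbol.

(** * The identity over a field, for distinct nonzero variables *)

Section FieldCase.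
Variables (F : fieldType) (n : nat) (u v w : F) (X : 'I_n -> F).
Hypothesis X0 : forall i, X i != 0.
Hypothesis X_inj : injective X.

Lemma vander_neq0 : vander (extend X) n != 0.
Proof.
apply/prodf_neq0 => j _; apply/prodf_neq0 => i _.
have ij := ltn_ord i; have jn := ltn_ord j.
rewrite extendE subr_eq0 -[nat_of_ord i]/(nat_of_ord (Ordinal (ltn_trans ij jn))) extendE.
by rewrite (inj_eq X_inj) -val_eqE /= gtn_eqF.
Qed.

Theorem MT_sum_field (k : 'I_n -> int) :
  (forall i j : 'I_n, (i < j)%N -> k i < k j) ->
  MT_sum u v w X k = op_apply (op_prod n u v w) (schur_rev X) k.
Proof.
move=> /strict_fseq hk; apply: (mulIf vander_neq0).
rewrite MT_sum_gen // mt_gen_bialternant ?size_fseq //; last exact: extend_neq0.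
transitivity (\sum_(s : 'S_n) (-1) ^+ odd_perm s *
   ((\prod_(p < n) X (s p) ^ (k p + p%:Z)) * symbol (op_prod n u v w) (fun p => X (s p)))).
  apply: eq_bigr => s _; congr (_ * _).
  under [X in _ * X]eq_bigr => p _ do rewrite nth_fseq extendE.
  rewrite symbol_op_prod //.
  have -> : pair_prod u v w (extend X) s =
      \prod_(p < n) \prod_(q < n | (p < q)%N) pairc u v w (X (s p)) (X (s q)).
    by apply: eq_bigr => p _; apply: eq_bigr => q _; rewrite !extendE.
  rewrite -prod_shift_pairc // mulrC mulrA -big_split; congr (_ * _).
  by apply: eq_bigr => p _; rewrite expfzDr.
rewrite /op_apply mulr_suml.
(* Shifting [k] by [t.2] multiplies the term of [s] in the alternant by the monomial of [t] in the
   variables [X (s p)]; the sum over [t] then rebuilds the symbol. *)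
under [RHS]eq_bigr => t _ do rewrite -mulrA /schur_rev schur_ext_alternant // mulr_sumr.
rewrite [RHS]exchange_big /=; apply: eq_bigr => s _.
rewrite /symbol !mulr_sumr; apply: eq_bigr => t _.
have -> : \prod_(p < n) (\matrix_(p, q) X q ^ (k (rev_ord (rev_ord p)) +
    t.2 (rev_ord (rev_ord p)) + p%:Z)) p (s p) =
  (\prod_(p < n) X (s p) ^ (k p + p%:Z)) * \prod_(p < n) X (s p) ^ t.2 p.
  rewrite -big_split; apply: eq_bigr => p _.
  by rewrite !mxE rev_ordK addrAC [LHS]expfzDr ?X0.
by rewrite [RHS]mulrCA; congr (_ * _); rewrite mulrCA.
Qed.
End FieldCase.

(** * Specialization from a fraction field to a commutative ring *)

Section Specialization.
Variables (A : idomainType) (R : comUnitRingType) (ev : {rmorphism A -> R}).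
Variables (n : nat) (x : 'I_n -> A) (X : 'I_n -> R).
Hypothesis x0 : forall i, x i != 0.
Hypothesis evX : forall i, ev (x i) = X i.
Hypothesis X_unit : forall i, X i \is a GRing.unit.
Notation K := {fraction A}.
Notation "p %:F" := (FracField.tofrac p).
Let M := \prod_(i < n) x i.
Let Xg i : K := (x i)%:F.

(* [specializes a b]: [a] lies in the localization A[1/M] of A inside its      *)
(* fraction field, and [b] is its image under the extension of [ev].          *)
Definition specializes (a : K) (b : R) := exists N p,
  a * M%:F ^+ N = p%:F /\ b * ev M ^+ N = ev p.

Lemma M_unit : ev M \is a GRing.unit.
Proof. by rewrite rmorph_prod; apply: unitr_prod => i _; rewrite evX. Qed.

(** Two representations of [a] agree in [A] after cross-multiplication; applying [ev] and cancelling
    the unit [ev M] gives the claim. *)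
Lemma specializes_inj a b b' : specializes a b -> specializes a b' -> b = b'.
Proof.
move=> [N [p [e1 e2]]] [N' [p' [e1' e2']]].
have e : p * M ^+ N' = p' * M ^+ N.
  by apply/eqP; rewrite -tofrac_eq !tofracM !tofracXn -e1 -e1' mulrAC.
apply: (mulIr (unitrX (N + N') M_unit)); rewrite exprD mulrA e2.
by rewrite [X in _ = _ * X]mulrC mulrA e2' -!rmorphXn -!rmorphM e.
Qed.

Lemma specializes_ev p : specializes p%:F (ev p).
Proof. by exists 0%N, p; rewrite !expr0 !mulr1. Qed.

Lemma specializes0 : specializes 0 0.
Proof. by have := specializes_ev 0; rewrite tofrac0 rmorph0. Qed.

Lemma specializes1 : specializes 1 1.
Proof. by have := specializes_ev 1; rewrite tofrac1 rmorph1. Qed.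

Lemma specializesD a b a' b' : specializes a b -> specializes a' b' ->
  specializes (a + a') (b + b').
Proof.
move=> [N [p [e1 e2]]] [N' [p' [e1' e2']]].
exists (N + N')%N, (p * M ^+ N' + p' * M ^+ N).
rewrite tofracD !tofracM rmorphD !rmorphM !tofracXn !rmorphXn /= -e1 -e1' -e2 -e2'.
by rewrite !exprD; split; ring.
Qed.

Lemma specializesM a b a' b' : specializes a b -> specializes a' b' ->
  specializes (a * a') (b * b').
Proof.
move=> [N [p [e1 e2]]] [N' [p' [e1' e2']]].
exists (N + N')%N, (p * p').
by rewrite tofracM rmorphM /= -e1 -e1' -e2 -e2' !exprD; split; ring.
Qed.

Lemma specializes_sum (I : Type) (s : seq I) (P : pred I) a b :
  (forall i, P i -> specializes (a i) (b i)) ->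
  specializes (\sum_(i <- s | P i) a i) (\sum_(i <- s | P i) b i).
Proof. by move=> h; elim/big_ind2: _ => //; [exact: specializes0 | move=> *; exact: specializesD]. Qed.

Lemma specializes_prod (I : Type) (s : seq I) (P : pred I) a b :
  (forall i, P i -> specializes (a i) (b i)) ->
  specializes (\prod_(i <- s | P i) a i) (\prod_(i <- s | P i) b i).
Proof. by move=> h; elim/big_ind2: _ => //; [exact: specializes1 | move=> *; exact: specializesM]. Qed.

Lemma specializesX a b N : specializes a b -> specializes (a ^+ N) (b ^+ N).
Proof.
by move=> h; elim: N => [|N IH]; [exact: specializes1 | rewrite !exprS; exact: specializesM].
Qed.

Lemma specializes_var i : specializes (Xg i) (X i).
Proof. by rewrite -evX; exact: specializes_ev. Qed.

Lemma specializesV i : specializes (Xg i)^-1 (X i)^-1.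
Proof.
(* The inverse of [x i] is the product of the other variables divided by [M]. *)
exists 1%N, (\prod_(j < n | j != i) x j); rewrite !expr1 /M (bigD1 i) //=.
rewrite tofracM rmorphM /= !mulrA mulVf ?tofrac_eq0 // evX mulVr //.
by rewrite !mul1r.
Qed.

Lemma specializesXz i (z : int) : specializes (Xg i ^ z) (X i ^ z).
Proof.
case: z => N; first exact/specializesX/specializes_var.
by rewrite !NegzE -!exprz_inv; exact/specializesX/specializesV.
Qed.

Lemma specializes_tri_sum S (P : pred (nat -> nat -> int)) (f : (nat -> nat -> int) -> K) g :
  (forall m, P m -> specializes (f m) (g m)) ->
  specializes (tri_sum n S P f) (tri_sum n S P g).
Proof. by move=> h; apply: specializes_sum => c /andP[_]; exact: h. Qed.

Lemma specializes_schur mu : specializes (schur Xg mu) (schur X mu).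
Proof.
apply: specializes_tri_sum => g _; apply: specializes_prod => i _.
exact: specializesXz.
Qed.

Lemma specializes_schur_ext lam : specializes (schur_ext Xg lam) (schur_ext X lam).
Proof.
rewrite /schur_ext; case: ifP => _; first exact: specializes0.
case: pickP => [s _|_]; last exact: specializes0.
apply: specializesM; last by apply: specializes_prod => i _; exact: specializesXz.
apply: specializesM; last exact: specializes_schur.
have := specializes_ev ((-1) ^+ odd_perm s).
by rewrite tofracXn tofracN tofrac1 rmorph_sign.
Qed.

(** Comparing the lists term by term suffices, since both operator products are built by the same
    recursion. *)
Fixpoint specializes_op (L1 : shift_op K n) (L2 : shift_op R n) : Prop :=
  match L1, L2 with
  | [::], [::] => True
  | t1 :: L1', t2 :: L2' =>
    [/\ specializes t1.1 t2.1, t1.2 = t2.2 & specializes_op L1' L2']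
  | _, _ => False
  end.

Lemma specializes_op_cat L1 L2 L1' L2' : specializes_op L1 L2 ->
  specializes_op L1' L2' -> specializes_op (L1 ++ L1') (L2 ++ L2').
Proof.
by elim: L1 L2 => [|t1 L1 IH] [|t2 L2] //= [h1 h2 h3] h; split=> //; exact: IH.
Qed.

Lemma specializes_op_mul L1 L2 L1' L2' : specializes_op L1 L2 ->
  specializes_op L1' L2' -> specializes_op (op_mul L1 L1') (op_mul L2 L2').
Proof.
elim: L1 L2 => [|t1 L1 IH] [|t2 L2] //= [h1 h2 h3] h.
apply: specializes_op_cat; last exact: IH.
elim: L1' L2' {IH} h => [|s1 L1' IH] [|s2 L2'] //= [h1' h2' h3']; split.
- exact: specializesM.
- by rewrite h2 h2'.
- exact: IH.
Qed.

Lemma specializes_op_apply L1 L2 f g k : specializes_op L1 L2 ->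
  (forall l, specializes (f l) (g l)) ->
  specializes (op_apply L1 f k) (op_apply L2 g k).
Proof.
move=> + h; elim: L1 L2 => [|t1 L1 IH] [|t2 L2] //=.
  by move=> _; rewrite /op_apply !big_nil; exact: specializes0.
move=> [h1 h2 h3]; rewrite /op_apply !big_cons h2.
by apply: specializesD; [exact: specializesM | exact: IH].
Qed.

Variables (u v w : A).

Lemma specializes_op_prod :
  specializes_op (op_prod n u%:F v%:F w%:F) (op_prod n (ev u) (ev v) (ev w)).
Proof.
rewrite /op_prod; elim: (ord_pairs n) => [|pq s IH] /=.
  by split=> //; exact: specializes1.
by apply: specializes_op_mul => //=; do !split=> //; exact: specializes_ev.
Qed.

Lemma specializes_MT_sum k :
  specializes (MT_sum u%:F v%:F w%:F Xg k) (MT_sum (ev u) (ev v) (ev w) X k).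
Proof.
apply: specializes_tri_sum => m _.
apply: specializesM.
  by apply: specializesM; apply: specializesX; exact: specializes_ev.
apply: specializes_prod => i _; apply: specializesM; first exact: specializesXz.
apply: specializesX; apply: specializesD; last first.
  by apply: specializesM; [exact: specializes_ev | exact: specializesV].
apply: specializesD; first exact: specializes_ev.
by apply: specializesM; [exact: specializes_ev | exact: specializes_var].
Qed.

(** By [MT_sum_field] both sides are images of one element of the fraction field, so
    [specializes_inj] identifies them. *)
Lemma MT_sum_specialize (k : 'I_n -> int) : injective x ->
  (forall i j : 'I_n, (i < j)%N -> k i < k j) ->
  MT_sum (ev u) (ev v) (ev w) X k =
  op_apply (op_prod n (ev u) (ev v) (ev w)) (schur_rev X) k.
Proof.
move=> x_inj hk; apply: specializes_inj (specializes_MT_sum k) _.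
rewrite MT_sum_field //; first last.
- by move=> i j /eqP; rewrite tofrac_eq => /eqP/x_inj.
- by move=> i; rewrite tofrac_eq0.
apply: specializes_op_apply; first exact: specializes_op_prod.
by move=> l; exact: specializes_schur_ext.
Qed.
End Specialization.

Theorem mainTheorem6 (R : comUnitRingType) (n : nat) (u v w : R)
    (X : 'I_n -> R) (k : 'I_n -> int)
    (hX : forall i, X i \is a GRing.unit)
    (hk : forall i j : 'I_n, (i < j)%N -> k i < k j) :
  MT_sum u v w X k = op_apply (op_prod n u v w) (schur_rev X) k.
Proof.
(* One indeterminate for each [X i] and three more for [u], [v], [w]; integer coefficients map to
   every ring. *)
pose A : idomainType := {mpoly int[n + 3]}.
pose val (j : 'I_(n + 3)) : R :=
  match split j with inl i => X i | inr i => [:: u; v; w]`_i end.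
pose ev : {rmorphism A -> R} := mmap (intmul 1) val.
pose var (j : 'I_(n + 3)) : A := mpolyX int (mnm1 j).
have evE j : ev (var j) = val j by rewrite /ev /= mmapX mmap1U.
have var_neq0 j : var j != 0.
  apply/eqP => /(congr1 (mcoeff (mnm1 j))).
  by rewrite mcoeffXU eqxx mcoeff0.
have var_inj : injective var.
  move=> i j /(congr1 (mcoeff (mnm1 j))).
  by rewrite !mcoeffXU eqxx; case: eqP.
pose x (i : 'I_n) := var (lshift 3 i).
have evx i : ev (x i) = X i by rewrite evE /val (unsplitK (inl i)).
pose param (i : 'I_3) := var (rshift n i).
have evp i : ev (param i) = [:: u; v; w]`_i by rewrite evE /val (unsplitK (inr i)).
have eu : ev (param ord0) = u by rewrite evp.
have ev' : ev (param (lift ord0 ord0)) = v by rewrite evp.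
have ew : ev (param ord_max) = w by rewrite evp.
(* The indeterminates are distinct even where the values [X i] coincide, which provides a nonzero
   [vander]. *)
have x_inj : injective x by move=> i j /var_inj; exact: lshift_inj.
have x0 i : x i != 0 by exact: var_neq0.
rewrite -eu -ev' -ew; exact: (MT_sum_specialize x0 evx hX).
Qed.
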